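(* Let $k$ be a field of characteristic $0$, let $p(t)$ be the Hilbert polynomial of some closed subscheme of $\mathbb{P}^n=\mathbb{P}^n_k$, and let $r,p,N,q$, $\mathcal{E}^{(0)}$, $\mathbb{B}$ and $\underline{\mathbf{G}}_{\mathcal{I},g}$ be as in the context. The collection of subfunctors $$\{\underline{\mathbf{G}}_{\mathcal{I},g}\mid g\in\mathrm{PGL}_{\mathbb{Q}}(n+1),\ \mathcal{I}\in\mathcal{E}^{(0)}\text{ such that }J(\mathcal{I})\in\mathbb{B}\}$$ covers the Grassmann functor $\underline{\mathbf{Gr}}_p^N$, and the representing schemes $\mathbf{G}_{\mathcal{I},g}$ cover the Grassmannian $\mathbf{Gr}_p^N$.
   Context: The Gotzmann number $r$ of $p(t)$ is the number of summands in the unique expression $p(t)=\sum_{i=1}^{r}\binom{t+a_i-i+1}{a_i}$ with $a_1\ge\dots\ge a_r\ge 0$; $N=\binom{n+r}{n}$, $p=p(r)$, $q=N-p$. Variables of $k[x]=k[x_0,\dots,x_n]$ are ordered $x_0<\dots<x_n$; $x^{\alpha(1)},\dots,x^{\alpha(N)}$ are the monomials of degree $r$ in descending degree reverse lexicographic order. The Grassmann functor $\underline{\mathbf{Gr}}_p^N$ sends a noetherian $k$-algebra $A$ to the set of submodules $L\subseteq A^N$ with $A^N/L$ locally free of rank $p$ (equivalently isomorphism classes of epimorphisms from $A^N$ onto locally free modules of rank $p$); $\pi_L:A^N\to A^N/L$ is the projection. The standard basis $\mathrm{a}_1,\dots,\mathrm{a}_N$ of $A^N$ is identified with $x^{\alpha(1)},\dots,x^{\alpha(N)}$,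 so that $A^N\simeq A[x]_r$. $\mathcal{E}^{(0)}$ is the set of $p$-multi-indices $\mathcal{I}=(i_1<\dots<i_p)$ in $\{1,\dots,N\}$; $\Gamma_{\mathcal{I}}:A^p\to A^N$ sends the $j$-th standard basis vector to $\mathrm{a}_{i_j}$; $J(\mathcal{I})$ is the monomial ideal generated by the monomials $x^{\alpha(j)}$ with $j\notin\mathcal{I}$. $\mathbb{B}$ is the set of Borel-fixed ideals of $k[x]$ generated by $q$ monomials of degree $r$; since $\operatorname{char}k=0$, Borel-fixed means strongly stable: monomial, and for each monomial $x^\alpha\in J$, each $x_i\mid x^\alpha$ and each $x_j>x_i$, also $\frac{x_j}{x_i}x^\alpha\in J$. For $g\in\mathrm{PGL}_{\mathbb{Q}}(n+1)$, $\widetilde g$ is the automorphism induced by the linear change of coordinates $g$ on $A[x]_r\simeq A^N$ (well defined up to a scalar), and $\underline{\mathbf{G}}_{\mathcal{I},g}(A)$ is the set of free rank-$p$ quotients $\pi_L:A^N\to A^N/L$ such that $\pi_L\circ\widetilde g\circ\Gamma_{\mathcal{I}}$ is surjective; this is an open subfunctor. A collection of open subfunctors covers a functor $\mathbf{F}$ if for every $A$, every $\xi\in\mathbf{F}(A)$ and every prime $\mathfrak{p}$ of $A$, the restriction of $\xi$ to some open neighborhood of $\mathfrak{p}$ in $\operatorname{Spec}A$ lies in some member of the collection. *)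

(* Defs.v *)
From HB Require Import structures.
From mathcomp Require Import all_boot all_order all_algebra.
From mathcomp Require Import mpoly.
From mathcomp Require Import boolp classical_sets topology_structure.

Set Implicit Arguments.
Unset Strict Implicit.
Unset Printing Implicit Defensive.

Import GRing.Theory.
Local Open Scope ring_scope.
Local Open Scope classical_set_scope.

(* Rings are [comPzRingType]s, so that the zero ring is
   allowed (as sections over the empty set, for instance), and a k-algebra is
   such a ring together with a ring morphism from k. *)

Section Ideals.
Variable A : comPzRingType.

Definition ideal (I : set A) : Prop :=
  [/\ I 0, forall a b, I a -> I b -> I (a + b) & forall c a, I a -> I (c * a)].

Definition prime_ideal (P : set A) : Prop :=
  [/\ ideal P, ~ P 1 & forall a b, P (a * b) -> P a \/ P b].

Definition noetherian : Prop :=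
  forall I, ideal I -> exists s : seq A, I = smallest ideal [set` s].

End Ideals.

(* [phi : A -> B] is the localization of A at the powers of f, that is,
   B = A_f is the coordinate ring of the basic open set D(f) of Spec A. *)
Definition localization_away (A B : comPzRingType) (f : A)
    (phi : {rmorphism A -> B}) : Prop :=
  [/\ exists g, phi f * g = 1,
      forall b, exists a m, phi f ^+ m * b = phi a
    & forall a, phi a = 0 -> exists m, f ^+ m * a = 0].

Definition submodule (A : comPzRingType) (N : nat) (L : set 'rV[A]_N) : Prop :=
  [/\ L 0, forall v w, L v -> L w -> L (v + w)
    & forall (c : A) v, L v -> L (c *: v)].

(* The rows of [b] project onto a basis of A^N / L. *)
Definition free_quotient (A : comPzRingType) (N p : nat) (L : set 'rV[A]_N) :
    Prop :=
  exists b : 'M[A]_(p, N),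
    (forall v, exists c : 'rV_p, L (v - c *m b)) /\
    (forall c : 'rV_p, L (c *m b) -> c = 0).

(* The kernel of B^N -> (A^N / L) (x)_A B: by right exactness of the tensor
   product it is the B-submodule spanned by the image of L. *)
Definition base_change (A B : comPzRingType) (N : nat)
    (phi : {rmorphism A -> B}) (L : set 'rV[A]_N) : set 'rV[B]_N :=
  smallest (@submodule B N) (map_mx phi @` L).

Definition locally_free_quotient (A : comPzRingType) (N p : nat)
    (L : set 'rV[A]_N) : Prop :=
  forall P : set A, prime_ideal P -> exists2 f, ~ P f &
    exists (B : comPzRingType) (phi : {rmorphism A -> B}),
      localization_away f phi /\ free_quotient p (base_change phi L).

(* Subfunctors of A |-> {submodules of A^N}, on k-algebras; restriction along
   a morphism of k-algebras is [base_change]. *)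

Definition submodule_functor (k : fieldType) (N : nat) :=
  forall A : comPzRingType, {rmorphism k -> A} -> set (set 'rV[A]_N).

Definition Gr (k : fieldType) (p N : nat) : submodule_functor k N :=
  fun A _ => [set L | submodule L /\ locally_free_quotient p L].
Arguments Gr : clear implicits.

(* The basic open sets D(f) with f not in P form a basis of neighborhoods of P
   in Spec A, whence the formulation with f and A_f. *)
Definition covers (k : fieldType) (N : nat) (F : submodule_functor k N)
    (C : Type) (G : C -> submodule_functor k N) : Prop :=
  forall (A : comPzRingType) (iota : {rmorphism k -> A}), noetherian A ->
  forall L, F A iota L -> forall P : set A, prime_ideal P ->
  exists2 f, ~ P f &
    exists (B : comPzRingType) (phi : {rmorphism A -> B}),
      localization_away f phi /\
      exists c : C, G c B (phi \o iota) (base_change phi L).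

(* Degree reverse lexicographic order; the variable of index 0 is the smallest
   one, so among monomials of the same degree the larger one has the smaller
   exponent at the first index where the exponents differ. *)
Definition drl_ge (n : nat) (a b : 'X_{1..n}) : bool :=
  (mdeg b < mdeg a)%N ||
  ((mdeg a == mdeg b) &&
   ((a == b) || [exists i : 'I_n, (a i < b i)%N &&
                  [forall j : 'I_n, (j < i)%N ==> (a j == b j)]])).

Definition monomials (n r : nat) : seq 'X_{1..n.+1} :=
  sort (@drl_ge n.+1)
    [seq val m | m <- enum {: 'X_{1..n.+1 < r.+1}} & mdeg (val m) == r].

Lemma mem_monomials (n r : nat) (m : 'X_{1..n.+1}) :
  (m \in monomials n r) = (mdeg m == r).
Proof.
rewrite mem_sort; apply/mapP/idP => [[b]|/eqP mr].
  by rewrite mem_filter => /andP[br _] ->.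
have lt_m : (mdeg m < r.+1)%N by rewrite mr.
by exists (BMultinom lt_m); rewrite // mem_filter /= mr eqxx mem_enum.
Qed.

Lemma uniq_monomials (n r : nat) : uniq (monomials n r).
Proof.
rewrite sort_uniq map_inj_uniq; last exact: val_inj.
by rewrite filter_uniq // enum_uniq.
Qed.

Lemma size_monomials (n r : nat) : size (monomials n r) = 'C(n + r, n).
Proof.
have -> : 'C(n + r, n) = 'C(r + n, r) by rewrite -bin_sub ?leq_addr // addKn addnC.
rewrite -(size_basis n r); apply: perm_size; apply: uniq_perm.
- exact: uniq_monomials.
- exact: uniq_basis.
- by move=> m; rewrite mem_monomials basis_cover.
Qed.

Definition mon (n r : nat) (j : 'I_('C(n + r, n))) : 'X_{1..n.+1} :=
  nth 0%MM (monomials n r) j.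
Arguments mon : clear implicits.

Definition homogeneous_ideal (k : fieldType) (n : nat)
    (I : set {mpoly k[n]}) : Prop :=
  ideal I /\ forall (f : {mpoly k[n]}) d, I f -> I (pihomog mdeg d f).

(* dim_k (k[x] / I)_d = m, with k[x]_d = k^N in the basis [mon n d] *)
Definition hilbert_function_eq (k : fieldType) (n : nat)
    (I : set {mpoly k[n.+1]}) (d m : nat) : Prop :=
  free_quotient m
    [set v : 'rV[k]_('C(n + d, n)) | I (\sum_j v 0 j *: 'X_[mon n d j])].

(* P is the Hilbert polynomial of Proj (k[x] / I) for some homogeneous I; every
   closed subscheme of the projective space is of this form. *)
Definition is_hilbert_polynomial (k : fieldType) (n : nat) (P : {poly rat}) :
    Prop :=
  exists2 I : set {mpoly k[n.+1]}, homogeneous_ideal I &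
  exists d0, forall d, (d0 <= d)%N ->
  exists2 m, hilbert_function_eq I d m & P.[d%:R] = m%:R.

Definition binomial_poly (u : {poly rat}) (a : nat) : {poly rat} :=
  (a`!%:R)^-1 *: \prod_(j < a) (u - j%:R).

(* Indices start at 0, whence t + a_i - i instead of t + a_i - i + 1. *)
Definition is_gotzmann_number (P : {poly rat}) (r : nat) : Prop :=
  exists2 a : r.-tuple nat, sorted geq a &
    P = \sum_(i < r) binomial_poly ('X + (tnth a i)%:R - i%:R) (tnth a i).

(* In characteristic 0, an ideal is Borel-fixed if and only if it is strongly
   stable in this sense. *)
Definition strongly_stable (k : fieldType) (n : nat)
    (J : set {mpoly k[n]}) : Prop :=
  [/\ ideal J, forall (f : {mpoly k[n]}) m, J f -> m \in msupp f -> J 'X_[m]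
    & forall (m : 'X_{1..n}) (i j : 'I_n), J 'X_[m] -> (0 < m i)%N ->
        (i < j)%N -> J 'X_[m - U_(i) + U_(j)]].

Definition BB (k : fieldType) (n r q : nat) : set (set {mpoly k[n.+1]}) :=
  [set J | strongly_stable J /\
    exists2 s : seq 'X_{1..n.+1},
      [/\ uniq s, size s = q & all (fun m => mdeg m == r) s]
      & J = smallest (@ideal {mpoly k[n.+1]}) [set 'X_[m] | m in [set` s]]].
Arguments BB : clear implicits.

(* J(I): the tuple I lists the indices i_1 < ... < i_p. *)
Definition JJ (k : fieldType) (n r p : nat) (I : p.-tuple 'I_('C(n + r, n))) :
    set {mpoly k[n.+1]} :=
  smallest (@ideal {mpoly k[n.+1]})
    [set 'X_[mon n r j] | j in [set j | j \notin I]].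
Arguments JJ : clear implicits.

(* Matrices act on row vectors from the right: [Gamma] is the matrix of the
   map sending the j-th basis vector to the one of index i_j, and row i of
   [gtilde] holds the coefficients of the image of the i-th monomial under
   x_l |-> \sum_m g_lm x_m.  It is defined over the rationals and transported
   to any algebra over a field of characteristic 0. *)

Definition Gamma (A : comPzRingType) (N p : nat) (I : p.-tuple 'I_N) :
    'M[A]_(p, N) :=
  \matrix_(j, l) (l == tnth I j)%:R.
Arguments Gamma : clear implicits.

Definition gtilde (n r : nat) (g : 'M[rat]_n.+1) : 'M[rat]_('C(n + r, n)) :=
  \matrix_(i, j) ('X_[mon n r i] \mPo
     [tuple \sum_m g l m *: 'X_m | l < n.+1] : {mpoly rat[n.+1]})@_(mon n r j).
Arguments gtilde : clear implicits.

(* The surjectivity of the composite A^p -> A^N -> A^N -> A^N / L. *)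
Definition GG (k : fieldType) (n r p : nat) (I : p.-tuple 'I_('C(n + r, n)))
    (g : 'M[rat]_n.+1) : submodule_functor k 'C(n + r, n) :=
  fun A iota => [set L | [/\ submodule L, free_quotient p L
    & forall v, exists c : 'rV[A]_p,
        L (v - c *m Gamma A _ _ I *m map_mx (iota \o ratr) (gtilde n r g))]].
Arguments GG : clear implicits.

(* The pairs (I, g) with J(I) in BB.  An element of PGL is given by an
   invertible matrix representing it: [gtilde (a *: g)] is a scalar multiple
   of [gtilde g], so [GG] only depends on the class of g. *)
Record borel_index (k : fieldType) (n r p : nat) := BorelIndex {
  bi_set : p.-tuple 'I_('C(n + r, n));
  bi_mat : 'M[rat]_n.+1;
  bi_sorted : sorted (fun i j => (i < j)%N) (map val bi_set);
  bi_unit : bi_mat \in unitmx;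
  bi_borel : BB k n r ('C(n + r, n) - p) (JJ k n r p bi_set)
}.
Arguments borel_index : clear implicits.

Record opens (T : topologicalType) := Opens {
  oset :> set T;
  oopen : open oset
}.

Definition opensT (T : topologicalType) : opens T := Opens (@openT T).

Definition preimo (S T : topologicalType) (f : S -> T) (cf : continuous f)
    (U : opens T) : opens S :=
  Opens (proj1 (continuousP f) cf U (oopen U)).

Record ringed_space (k : fieldType) := RingedSpace {
  space :> topologicalType;
  sect : opens space -> comPzRingType;
  res : forall U V : opens space, V `<=` U -> {rmorphism sect U -> sect V};
  res_id : forall (U : opens space) (h : U `<=` U) s, res h s = s;
  res_comp : forall (U V W : opens space) (h1 : V `<=` U) (h2 : W `<=` V)
    (h3 : W `<=` U) s, res h2 (res h1 s) = res h3 s;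
  sheaf : forall (C : Type) (U : opens space) (V : C -> opens space)
    (h : forall c, V c `<=` U), U `<=` \bigcup_c V c ->
    forall s : forall c, sect (V c),
    (forall c d (W : opens space) (hc : W `<=` V c) (hd : W `<=` V d),
      res hc (s c) = res hd (s d)) ->
    exists! t : sect U, forall c, res (h c) t = s c;
  scal : {rmorphism k -> sect (opensT space)}
}.
Arguments sect {k} r _.
Arguments scal {k} r.

(* The section s has invertible germ at x. *)
Definition unit_at (k : fieldType) (X : ringed_space k) (U : opens X)
    (s : sect X U) (x : X) : Prop :=
  exists (V : opens X) (h : V `<=` U), oset V x /\ exists t, res h s * t = 1.

Definition non_units_at (k : fieldType) (X : ringed_space k) (U : opens X)
    (x : X) : set (sect X U) :=
  [set s | ~ unit_at s x].
Arguments non_units_at {k X} U x.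

(* The restriction of X to U is the spectrum of A = O(U): points of U
   correspond to the primes of A, the sets D(s) form a basis of the topology
   and O(D(s)) = A_s for all s. *)
Definition affine (k : fieldType) (X : ringed_space k) (U : opens X) : Prop :=
  [/\ forall x, oset U x -> prime_ideal (non_units_at U x),
      forall P, prime_ideal P -> exists! x, oset U x /\ non_units_at U x = P,
      forall (x : X) (V : opens X), oset U x -> oset V x -> exists2 s : sect X U,
        unit_at s x & forall y, oset U y -> unit_at s y -> oset V y
    & forall (s : sect X U) (V : opens X) (h : V `<=` U),
        (forall y, oset V y <-> oset U y /\ unit_at s y) -> localization_away s (res h)].

Record scheme (k : fieldType) := Scheme {
  rspace :> ringed_space k;
  locally_affine : forall x : rspace, exists2 U : opens rspace, oset U x & affine U
}.

(* Global sections, as a k-algebra through [scal]. *)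
Definition glob (k : fieldType) (X : scheme k) : comPzRingType :=
  sect X (opensT X).

Definition affine_noetherian (k : fieldType) (Y : scheme k) : Prop :=
  affine (opensT Y) /\ noetherian (glob Y).

Record mor (k : fieldType) (X Y : scheme k) := Mor {
  pmap :> X -> Y;
  pmap_cont : continuous pmap;
  smap : forall U : opens Y,
    {rmorphism sect Y U -> sect X (preimo pmap_cont U)};
  smap_res : forall (U V : opens Y) (h : V `<=` U)
    (h' : preimo pmap_cont V `<=` preimo pmap_cont U) s,
    smap V (res h s) = res h' (smap U s);
  smap_local : forall (U : opens Y) s x, oset U (pmap x) ->
    unit_at (smap U s) x -> unit_at s (pmap x);
  smap_scal : forall (h : preimo pmap_cont (opensT Y) `<=` opensT X) c,
    smap (opensT Y) (scal Y c) = res h (scal X c)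
}.

Arguments pmap_cont {k X Y} _.

Definition glob_map (k : fieldType) (X Y : scheme k) (f : mor X Y) :
    {rmorphism glob Y -> glob X} :=
  res (U := preimo (pmap_cont f) (opensT Y)) (V := opensT X) (fun _ _ => I)
    \o smap f (opensT Y).

Definition mor_eq (k : fieldType) (X Y : scheme k) (f g : mor X Y) : Prop :=
  (forall x, f x = g x) /\
  forall (U : opens Y) s
    (h : preimo (pmap_cont g) U `<=` preimo (pmap_cont f) U),
    res h (smap f U s) = smap g U s.

(* h is the composite of f : X -> Y and g : Y -> Z. *)
Definition is_comp (k : fieldType) (X Y Z : scheme k) (f : mor X Y)
    (g : mor Y Z) (h : mor X Z) : Prop :=
  (forall x, h x = g (f x)) /\
  forall (U : opens Z) s
    (i : preimo (pmap_cont h) U `<=`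
         preimo (pmap_cont f) (preimo (pmap_cont g) U)),
    res i (smap f _ (smap g U s)) = smap h U s.

(* X represents F: an isomorphism between Y |-> Hom_k(Y, X) and Y |-> F(O(Y))
   on affine noetherian k-schemes Y, i.e. on spectra of noetherian
   k-algebras. *)
Record representation (k : fieldType) (N : nat) (F : submodule_functor k N)
    (X : scheme k) := Representation {
  fam : forall Y : scheme k, mor Y X -> set 'rV[glob Y]_N;
  fam_in : forall Y, affine_noetherian Y -> forall f : mor Y X,
    F (glob Y) (scal Y) (fam f);
  fam_inj : forall Y, affine_noetherian Y -> forall f g : mor Y X,
    fam f = fam g -> mor_eq f g;
  fam_surj : forall Y, affine_noetherian Y -> forall L,
    F (glob Y) (scal Y) L -> exists f : mor Y X, fam f = L;
  fam_nat : forall Y Z, affine_noetherian Y -> affine_noetherian Z ->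
    forall (h : mor Z Y) (f : mor Y X) (f' : mor Z X), is_comp h f f' ->
    fam f' = base_change (glob_map h) (fam f)
}.

(* j : U -> X is the morphism corresponding to the inclusion of functors
   G <= F under the given representations. *)
Definition induces_inclusion (k : fieldType) (N : nat)
    (F G : submodule_functor k N) (X U : scheme k)
    (rho : representation F X) (sigma : representation G U) (j : mor U X) :
    Prop :=
  forall Y, affine_noetherian Y -> forall (u : mor Y U) (f : mor Y X),
    is_comp u j f -> fam rho f = fam sigma u.

(* Main.v *)
Require Import Defs.
From HB Require Import structures.
From mathcomp Require Import all_boot all_order all_algebra.
From mathcomp Require Import generic_quotient ring.
From mathcomp Require Import mpoly.
From mathcomp Require Import boolp classical_sets functions topology_structure.

Set Implicit Arguments.
Unset Strict Implicit.
Unset Printing Implicit Defensive.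

Import GRing.Theory.
Local Open Scope ring_scope.
Local Open Scope classical_set_scope.

(* Let A^N / L be locally free of rank p and P a prime of A. After localizing,
   L is the kernel of a matrix Q : A^N -> A^p, and L belongs to G_{I,g} as soon
   as a p-minor of gtilde(g) Q is invertible; so it suffices that this minor be
   nonzero over the residue field K of P. There this is Galligo's theorem: take
   g in GL(Q) maximizing the sum over h of the ranks of the last rows (those of
   index >= h) of M = gtilde(g) Q, and let I be the set of rows of M that do not
   lie in the span of the following ones. Suppose that m is not in I while
   m' = x_j m / x_i is in I, with x_i < x_j. There is a combination f of m and
   smaller monomials with f M = 0. Under x_i |-> x_i + t x_j the vector f M
   becomes t (c (row m') + rows after m') + O(t^2) with c > 0, so for almost all
   t the rank of the rows after m' increases, against maximality.

   For the schemes, the residue field at a point x of the representing scheme X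
   gives a morphism Spec K -> X with image x. The first part places the
   corresponding family in some G_{I,g}(K), so that the morphism factors through
   the scheme representing G_{I,g}. *)

(** * Rings of fractions *)

(* Data for S^-1 (A / J), with J = [fnull] and S = [fden]. The torsion of f and
   its powers give A_f; a prime P and its complement give the residue field. *)
Record frac_data (A : comPzRingType) := FracData {
  fnull : set A;
  fden : set A;
  fnull_ideal : ideal fnull;
  fden1 : fden 1;
  fdenM : forall s t, fden s -> fden t -> fden (s * t);
  fnull_sat : forall s x, fden s -> fnull (s * x) -> fnull x
}.

Section Fractions.
Variables (A : comPzRingType) (D : frac_data A).

Local Notation J := (fnull D).
Local Notation S := (fden D).

Definition fpair := {x : A * A | `[< S x.2 >]}.

Definition mkpair (a s : A) (hs : S s) : fpair :=
  exist (fun x => `[< S x.2 >]) (a, s) (introT (asboolP _) hs).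

Definition fnum (x : fpair) := (val x).1.
Definition fden_of (x : fpair) := (val x).2.

Lemma fden_of_in x : S (fden_of x).
Proof. by case: x => -[a s] h; exact/asboolP. Qed.

Definition frac_rel (x y : fpair) : bool :=
  `[< J (fnum x * fden_of y - fnum y * fden_of x) >].

Let J0 : J 0. Proof. by case: (fnull_ideal D). Qed.
Let JD a b : J a -> J b -> J (a + b).
Proof. by case: (fnull_ideal D) => _ + _; apply. Qed.
Let JM c a : J a -> J (c * a).
Proof. by case: (fnull_ideal D) => _ _; apply. Qed.
Let JN a : J a -> J (- a).
Proof. by move=> Ja; rewrite -mulN1r; apply: JM. Qed.

Lemma frac_rel_refl : reflexive frac_rel.
Proof. by move=> x; apply/asboolP; rewrite subrr. Qed.

Lemma frac_rel_sym : ssrbool.symmetric frac_rel.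
Proof.
by move=> x y; apply/asboolP/asboolP => /JN; rewrite opprB.
Qed.

(** The cross-difference of x and z, multiplied by the middle denominator, is a combination of the
    two given ones; [fnull_sat] cancels that denominator. *)
Lemma frac_rel_trans : transitive frac_rel.
Proof.
move=> y x z /asboolP xy /asboolP yz; apply/asboolP.
apply: (fnull_sat (fden_of_in y)).
have -> : fden_of y * (fnum x * fden_of z - fnum z * fden_of x) =
  fden_of z * (fnum x * fden_of y - fnum y * fden_of x) +
  fden_of x * (fnum y * fden_of z - fnum z * fden_of y) by ring.
by apply: JD; apply: JM.
Qed.

Definition frac_rel_equiv := EquivRel frac_rel frac_rel_refl frac_rel_sym frac_rel_trans.
Canonical frac_rel_equiv.

Definition fracs := {eq_quot frac_rel}%qT.
HB.instance Definition _ := Choice.on fracs.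
HB.instance Definition _ : EqQuotient _ frac_rel fracs := EqQuotient.on fracs.

Definition frac_class (a s : A) (hs : S s) : fracs := (\pi_fracs (mkpair a hs))%qT.

Lemma frac_classP (z : fracs) : exists a s (hs : S s), z = frac_class a hs.
Proof.
elim/quotW: z => -[[a s] h]; exists a, s, (elimT (asboolP _) h).
by rewrite /frac_class /mkpair; congr (\pi_fracs _)%qT; apply: val_inj.
Qed.

Lemma frac_class_eq a s (hs : S s) b t (ht : S t) :
  frac_class a hs = frac_class b ht <-> J (a * t - b * s).
Proof.
rewrite /frac_class; split; first by move/eqmodP => /asboolP.
by move=> h; apply/eqmodP/asboolP.
Qed.

Definition fpair_add (x y : fpair) : fpair :=
  mkpair (fnum x * fden_of y + fnum y * fden_of x) (fdenM (fden_of_in x) (fden_of_in y)).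
Definition fpair_mul (x y : fpair) : fpair :=
  mkpair (fnum x * fnum y) (fdenM (fden_of_in x) (fden_of_in y)).
Definition fpair_opp (x : fpair) : fpair := mkpair (- fnum x) (fden_of_in x).

(** Operations act on chosen representatives; [frac_addE], [frac_mulE] and [frac_oppE] then show
    that any representatives give the same class. *)
Definition frac_add (x y : fracs) : fracs :=
  (\pi_fracs (fpair_add (repr x) (repr y)))%qT.
Definition frac_mul (x y : fracs) : fracs :=
  (\pi_fracs (fpair_mul (repr x) (repr y)))%qT.
Definition frac_opp (x : fracs) : fracs := (\pi_fracs (fpair_opp (repr x)))%qT.

Lemma repr_frac_class a s (hs : S s) :
  J (fnum (repr (frac_class a hs)) * s - a * fden_of (repr (frac_class a hs))).
Proof.
have : frac_rel (repr (frac_class a hs)) (mkpair a hs) by apply/eqmodP; rewrite reprK.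
by move/asboolP.
Qed.

Lemma frac_addE a s (hs : S s) b t (ht : S t) :
  frac_add (frac_class a hs) (frac_class b ht) = frac_class (a * t + b * s) (fdenM hs ht).
Proof.
apply/frac_class_eq; have := repr_frac_class a hs; have := repr_frac_class b ht.
set x := repr (frac_class a hs); set y := repr (frac_class b ht) => hy hx.
have -> : (fnum x * fden_of y + fnum y * fden_of x) * (s * t) -
   (a * t + b * s) * (fden_of x * fden_of y) =
   (t * fden_of y) * (fnum x * s - a * fden_of x) +
   (s * fden_of x) * (fnum y * t - b * fden_of y) by ring.
by apply: JD; apply: JM.
Qed.

Lemma frac_mulE a s (hs : S s) b t (ht : S t) :
  frac_mul (frac_class a hs) (frac_class b ht) = frac_class (a * b) (fdenM hs ht).
Proof.
apply/frac_class_eq; have := repr_frac_class a hs; have := repr_frac_class b ht.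
set x := repr (frac_class a hs); set y := repr (frac_class b ht) => hy hx.
have -> : fnum x * fnum y * (s * t) - a * b * (fden_of x * fden_of y) =
   (fnum y * t) * (fnum x * s - a * fden_of x) +
   (a * fden_of x) * (fnum y * t - b * fden_of y) by ring.
by apply: JD; apply: JM.
Qed.

Lemma frac_oppE a s (hs : S s) : frac_opp (frac_class a hs) = frac_class (- a) hs.
Proof.
apply/frac_class_eq; have := repr_frac_class a hs; set x := repr (frac_class a hs) => hx.
have -> : - fnum x * s - - a * fden_of x = - (fnum x * s - a * fden_of x) by ring.
exact: JN.
Qed.

Definition frac_opE := (frac_addE, frac_mulE, frac_oppE).

(** For each ring axiom the cross-difference of the two sides is identically 0 already in A. *)
Lemma frac_addA : associative frac_add.
Proof.
move=> x y z; have [a [s [hs ->]]] := frac_classP x.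
have [b [t [ht ->]]] := frac_classP y; have [c [u [hu ->]]] := frac_classP z.
by rewrite !frac_opE; apply/frac_class_eq; rewrite (_ : _ - _ = 0) //; ring.
Qed.

Lemma frac_addC : commutative frac_add.
Proof.
move=> x y; have [a [s [hs ->]]] := frac_classP x; have [b [t [ht ->]]] := frac_classP y.
by rewrite !frac_opE; apply/frac_class_eq; rewrite (_ : _ - _ = 0) //; ring.
Qed.

Lemma frac_add0 : left_id (frac_class 0 (fden1 D)) frac_add.
Proof.
move=> x; have [a [s [hs ->]]] := frac_classP x.
by rewrite !frac_opE; apply/frac_class_eq; rewrite (_ : _ - _ = 0) //; ring.
Qed.

Lemma frac_addN : left_inverse (frac_class 0 (fden1 D)) frac_opp frac_add.
Proof.
move=> x; have [a [s [hs ->]]] := frac_classP x.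
by rewrite !frac_opE; apply/frac_class_eq; rewrite (_ : _ - _ = 0) //; ring.
Qed.

HB.instance Definition _ := GRing.isZmodule.Build fracs frac_addA frac_addC frac_add0 frac_addN.

Lemma frac_mulA : associative frac_mul.
Proof.
move=> x y z; have [a [s [hs ->]]] := frac_classP x.
have [b [t [ht ->]]] := frac_classP y; have [c [u [hu ->]]] := frac_classP z.
by rewrite !frac_opE; apply/frac_class_eq; rewrite (_ : _ - _ = 0) //; ring.
Qed.

Lemma frac_mulC : commutative frac_mul.
Proof.
move=> x y; have [a [s [hs ->]]] := frac_classP x; have [b [t [ht ->]]] := frac_classP y.
by rewrite !frac_opE; apply/frac_class_eq; rewrite (_ : _ - _ = 0) //; ring.
Qed.

Lemma frac_mul1 : left_id (frac_class 1 (fden1 D)) frac_mul.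
Proof.
move=> x; have [a [s [hs ->]]] := frac_classP x.
by rewrite !frac_opE; apply/frac_class_eq; rewrite (_ : _ - _ = 0) //; ring.
Qed.

Lemma frac_mulDl : left_distributive frac_mul frac_add.
Proof.
move=> x y z; have [a [s [hs ->]]] := frac_classP x.
have [b [t [ht ->]]] := frac_classP y; have [c [u [hu ->]]] := frac_classP z.
by rewrite !frac_opE; apply/frac_class_eq; rewrite (_ : _ - _ = 0) //; ring.
Qed.

HB.instance Definition _ :=
  GRing.Zmodule_isComPzRing.Build fracs frac_mulA frac_mulC frac_mul1 frac_mulDl.

Definition to_fracs (a : A) : fracs := frac_class a (fden1 D).

Lemma to_fracs_zmod : zmod_morphism to_fracs.
Proof.
move=> a b; rewrite /to_fracs.
rewrite [RHS](_ : _ = frac_add (frac_class a (fden1 D)) (frac_opp (frac_class b (fden1 D)))) //.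
by rewrite !frac_opE; apply/frac_class_eq; rewrite (_ : _ - _ = 0) //; ring.
Qed.

Lemma to_fracs_monoid : monoid_morphism to_fracs.
Proof.
split=> // a b; rewrite /to_fracs.
rewrite [RHS](_ : _ = frac_mul (frac_class a (fden1 D)) (frac_class b (fden1 D))) //.
by rewrite !frac_opE; apply/frac_class_eq; rewrite (_ : _ - _ = 0) //; ring.
Qed.

HB.instance Definition _ :=
  GRing.isZmodMorphism.Build A fracs to_fracs to_fracs_zmod.
HB.instance Definition _ :=
  GRing.isMonoidMorphism.Build A fracs to_fracs to_fracs_monoid.

Lemma to_fracs_eq0 a : to_fracs a = 0 <-> J a.
Proof. by rewrite frac_class_eq mulr1 mul0r subr0. Qed.

Lemma to_fracs_unit s : S s -> exists t : fracs, to_fracs s * t = 1.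
Proof.
move=> hs; exists (frac_class 1 hs).
rewrite [LHS](_ : _ = frac_mul (frac_class s (fden1 D)) (frac_class 1 hs)) // frac_mulE.
by apply/frac_class_eq; rewrite (_ : _ - _ = 0) //; ring.
Qed.

Lemma to_fracs_surj (z : fracs) :
  exists a s, S s /\ to_fracs s * z = to_fracs a.
Proof.
have [a [s [hs ->]]] := frac_classP z; exists a, s; split=> //.
rewrite [LHS](_ : _ = frac_mul (frac_class s (fden1 D)) (frac_class a hs)) // frac_mulE.
by apply/frac_class_eq; rewrite (_ : _ - _ = 0) //; ring.
Qed.

End Fractions.

(** * The residue field of a prime *)

Section ResidueField.
Variables (A : comPzRingType) (P : set A) (hP : prime_ideal P).

Let compl1 : ~ P 1. Proof. by case: hP. Qed.
Let complM s t : ~ P s -> ~ P t -> ~ P (s * t).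
Proof. by case: hP => _ _ h hs ht /h[]. Qed.
Let compl_sat s x : ~ P s -> P (s * x) -> P x.
Proof. by case: hP => _ _ h hs /h[]. Qed.
Let idP : ideal P. Proof. by case: hP. Qed.

Definition residue_data : frac_data A :=
  @FracData A P (fun s => ~ P s) idP compl1 complM compl_sat.

Definition residue_field := fracs residue_data.
HB.instance Definition _ := GRing.ComPzRing.on residue_field.

Definition to_residue : {rmorphism A -> residue_field} :=
  @to_fracs A residue_data.

Lemma residue_eq0 a : to_residue a = 0 <-> P a.
Proof. exact: (@to_fracs_eq0 A residue_data). Qed.

Lemma residue_surj (z : residue_field) :
  exists a s, ~ P s /\ to_residue s * z = to_residue a.
Proof. exact: (@to_fracs_surj A residue_data). Qed.

Lemma residue_neq0 : 1 != 0 :> residue_field.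
Proof. by apply/eqP; rewrite -(rmorph1 to_residue) residue_eq0. Qed.

HB.instance Definition _ :=
  GRing.PzSemiRing_isNonZero.Build residue_field residue_neq0.

(** If [s z = a] with z nonzero, then a lies outside P, hence becomes invertible, and s / a inverts
    z. The value 0 at 0 is the convention of the field structure. *)
Lemma residue_has_inv (z : residue_field) :
  exists w, (z != 0 -> w * z = 1) /\ (z = 0 -> w = 0).
Proof.
have [->|z0] := eqVneq z 0; first by exists 0; split; rewrite ?eqxx.
have [a [s [hs e]]] := residue_surj z.
have [t ht] : exists t, to_residue s * t = 1.
  exact: (@to_fracs_unit A residue_data).
have ha : ~ P a.
  rewrite -residue_eq0 -e => /(congr1 ( *%R t)).
  by rewrite mulrA (mulrC t) ht mul1r mulr0 => /eqP; apply/negP.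
have [u hu] : exists t, to_residue a * t = 1.
  exact: (@to_fracs_unit A residue_data).
exists (to_residue s * u); split=> // [_|/eqP]; last by move: z0 => /negPf->.
by rewrite mulrAC e.
Qed.

Definition residue_inv (z : residue_field) := projT1 (cid (residue_has_inv z)).

Lemma residue_mulVf z : z != 0 -> residue_inv z * z = 1.
Proof. by rewrite /residue_inv; case: cid => w []. Qed.

Lemma residue_inv0 : residue_inv 0 = 0.
Proof. by rewrite /residue_inv; case: cid => w [_] /= ->. Qed.

HB.instance Definition _ :=
  GRing.ComNzRing_isField.Build residue_field residue_mulVf residue_inv0.

End ResidueField.

Lemma prime_residue_field (A : comPzRingType) (P : set A) : prime_ideal P ->
  exists (K : fieldType) (kappa : {rmorphism A -> K}),
  (forall a, kappa a = 0 <-> P a) /\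
  forall z, exists a s, kappa s != 0 /\ kappa s * z = kappa a.
Proof.
move=> hP; exists (residue_field hP), (to_residue hP); split=> [a|z].
  exact: residue_eq0.
have [a [s [hs e]]] := residue_surj z; exists a, s; split=> //.
by apply/eqP => /residue_eq0.
Qed.

(** * Localization at the powers of an element *)

Section LocalizationAway.
Variables (A : comPzRingType) (f : A).

Let powers s := exists m, s = f ^+ m.
Let torsion x := exists m, f ^+ m * x = 0.

Let torsion_ideal : @ideal A torsion.
Proof.
split=> [|a b [m ea] [l eb]|c a [m ea]]; first by exists 0; rewrite mulr0.
  exists (m + l)%N; rewrite mulrDr exprD -{1}[f ^+ m * _]mulrC -!mulrA ea eb.
  by rewrite !mulr0 addr0.
by exists m; rewrite mulrCA ea mulr0.
Qed.

Let powers1 : powers 1. Proof. by exists 0%N. Qed.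
Let powersM s t : powers s -> powers t -> powers (s * t).
Proof. by case=> m -> [l ->]; exists (m + l)%N; rewrite exprD. Qed.
Let torsion_sat s x : powers s -> torsion (s * x) -> torsion x.
Proof. by case=> m -> [l e]; exists (l + m)%N; rewrite exprD -mulrA. Qed.

Definition away_data : frac_data A :=
  @FracData A torsion powers torsion_ideal powers1 powersM torsion_sat.

Lemma exists_localization_away :
  exists (B : comPzRingType) (phi : {rmorphism A -> B}),
    localization_away f phi.
Proof.
exists (fracs away_data), (@to_fracs A away_data); split.
- by apply: to_fracs_unit; exists 1%N.
- move=> b; have [a [s [[m ->] e]]] := to_fracs_surj b.
  by exists a, m; rewrite -rmorphXn.
- by move=> a /to_fracs_eq0.
Qed.

End LocalizationAway.

(** * Monomials and the order *)

Lemma ex_ord_min (n : nat) (Q : pred 'I_n) :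
  (exists i, Q i) -> exists2 i, Q i & forall j : 'I_n, (j < i)%N -> ~~ Q j.
Proof.
case=> i0 Qi0; case: (@arg_minnP _ i0 Q (@nat_of_ord n) Qi0) => i Qi min_i.
by exists i => // j; rewrite ltnNge; apply: contra; apply: min_i.
Qed.

(* The strict order underlying [drl_ge], between monomials of equal degree. *)
Definition drl_gt (n : nat) (a b : 'X_{1..n}) : bool :=
  [exists i : 'I_n, (a i < b i)%N && [forall j : 'I_n, (j < i)%N ==> (a j == b j)]].

Lemma drl_gtP (n : nat) (a b : 'X_{1..n}) :
  reflect (exists2 i : 'I_n, (a i < b i)%N & forall j : 'I_n, (j < i)%N -> a j = b j)
          (drl_gt a b).
Proof.
apply: (iffP existsP) => [[i /andP[ab /forallP h]]|[i ab h]]; exists i => //.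
  by move=> j ji; apply/eqP; move: (h j); rewrite ji.
by rewrite ab; apply/forallP => j; apply/implyP => /h ->.
Qed.

Lemma drl_gt_irr (n : nat) (a : 'X_{1..n}) : drl_gt a a = false.
Proof. by apply/drl_gtP => -[i]; rewrite ltnn. Qed.

Lemma drl_gt_trans (n : nat) : transitive (@drl_gt n).
Proof.
move=> b a c /drl_gtP[i ab hab] /drl_gtP[j bc hbc]; apply/drl_gtP.
have [ij|ji|/val_inj eij] := ltngtP i j.
- exists i; first by rewrite -hbc.
  by move=> l li; rewrite hab // hbc // (ltn_trans li).
- exists j; first by rewrite hab.
  by move=> l lj; rewrite hab ?hbc // (ltn_trans lj).
- subst j; exists i; first exact: ltn_trans bc.
  by move=> l li; rewrite hab ?hbc.
Qed.

Lemma drl_gt_total (n : nat) (a b : 'X_{1..n}) :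
  a != b -> drl_gt a b || drl_gt b a.
Proof.
move=> ab; have /ex_ord_min[i nab h] : exists i, a i != b i.
  apply/existsP; apply: contraNT ab => /existsPn h.
  by apply/eqP/mnmP => i; apply/eqP; have := h i; rewrite negbK.
have {}h (j : 'I_n) : (j < i)%N -> a j = b j.
  by move=> /h; rewrite negbK => /eqP.
move: nab; rewrite neq_ltn => /orP[lt|lt]; apply/orP; [left|right].
  by apply/drl_gtP; exists i.
by apply/drl_gtP; exists i => // j /h.
Qed.

Lemma drl_ge_total (n : nat) : total (@drl_ge n).
Proof.
move=> a b; rewrite /drl_ge -/(drl_gt a b) -/(drl_gt b a).
case: ltngtP; rewrite ?orbT //= => _.
by have [->|/drl_gt_total/orP[->|->]] := eqVneq a b; rewrite ?orbT.
Qed.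

Lemma drl_ge_trans (n : nat) : transitive (@drl_ge n).
Proof.
move=> b a c; rewrite /drl_ge -/(drl_gt a b) -/(drl_gt b c) -/(drl_gt a c).
move=> /orP[lab|/andP[/eqP eab gab]] /orP[lbc|/andP[/eqP ebc gbc]].
- by rewrite (ltn_trans lbc lab).
- by rewrite -ebc lab.
- by rewrite eab lbc.
- rewrite eab ebc ltnn eqxx /=.
  move: gab gbc => /orP[/eqP->//|gab] /orP[/eqP<-|gbc]; first by rewrite gab orbT.
  by rewrite (drl_gt_trans gab gbc) orbT.
Qed.

Section Monomials.
Variables n r : nat.

Local Notation N := 'C(n + r, n).

Lemma mdeg_mon (i : 'I_N) : mdeg (mon n r i) = r.
Proof.
by apply/eqP; rewrite -mem_monomials mem_nth // size_monomials.
Qed.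

Lemma mon_inj : injective (mon n r).
Proof.
move=> i j /eqP; rewrite nth_uniq ?size_monomials ?uniq_monomials //.
by move/eqP/val_inj.
Qed.

Lemma mon_surj (m : 'X_{1..n.+1}) : mdeg m = r -> exists i, mon n r i = m.
Proof.
move=> /eqP; rewrite -mem_monomials => hm.
have lt : (index m (monomials n r) < N)%N by rewrite -size_monomials index_mem.
by exists (Ordinal lt); rewrite /mon nth_index.
Qed.

(** The list [monomials] is sorted in descending order, so later rows belong to smaller monomials;
    injectivity of [mon] makes the comparison strict. *)
Lemma drl_gt_mon (i j : 'I_N) : drl_gt (mon n r i) (mon n r j) = (i < j)%N.
Proof.
have lt_gt (u v : 'I_N) : (u < v)%N -> drl_gt (mon n r u) (mon n r v).
  move=> uv; have : drl_ge (mon n r u) (mon n r v).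
    apply: (sorted_ltn_nth (@drl_ge_trans n.+1)) => //.
    + exact/sort_sorted/drl_ge_total.
    + by rewrite inE size_monomials.
    + by rewrite inE size_monomials.
  rewrite /drl_ge !mdeg_mon ltnn eqxx /= => /orP[/eqP/mon_inj e|//].
  by rewrite e ltnn in uv.
apply/idP/idP => [gt|]; last exact: lt_gt.
rewrite ltnNge leq_eqVlt; apply/negP => /orP[/eqP/val_inj e|/lt_gt gt'].
  by rewrite e drl_gt_irr in gt.
by have := drl_gt_trans gt gt'; rewrite drl_gt_irr.
Qed.

End Monomials.

Section Shift.
Variable n : nat.
Implicit Types (m : 'X_{1..n}) (i j : 'I_n).

(* x_j^b x_i^(-b) x^m, meaningful only for b <= m i. *)
Definition shift i j b m : 'X_{1..n} := (m - U_(i) *+ b + U_(j) *+ b)%MM.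

Lemma shiftE i j b m l :
  shift i j b m l = (m l - (i == l) * b + (j == l) * b)%N.
Proof. by rewrite /shift mnmDE mnmBE !mulmnE !mnm1E. Qed.

Lemma shift0 i j m : shift i j 0 m = m.
Proof. by apply/mnmP => l; rewrite shiftE !muln0 subn0 addn0. Qed.

Lemma mdeg_shift i j b m : (b <= m i)%N -> mdeg (shift i j b m) = mdeg m.
Proof.
move=> bm; have le : (U_(i) *+ b <= m)%MM.
  apply/mnm_lepP => l; rewrite mulmnE mnm1E.
  by case: eqP => [<-|]; rewrite ?mul1n ?mul0n.
by rewrite /shift mdegD !mdegMn !mdeg1 -{2}(submK le) mdegD mdegMn mdeg1.
Qed.

(** The first exponent to change is that of [x_i], because i < j, and it drops. *)
Lemma drl_gt_shift i j m : (i < j)%N -> (0 < m i)%N -> drl_gt (shift i j 1 m) m.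
Proof.
move=> ij mi; apply/drl_gtP; exists i.
  by rewrite shiftE -!val_eqE eqxx (gtn_eqF ij) muln1 mul0n addn0 subn1 prednK.
move=> l li; rewrite shiftE -!val_eqE.
by rewrite (gtn_eqF li) (gtn_eqF (ltn_trans li ij)) mul0n subn0 addn0.
Qed.

(** Both exponent vectors change by the same amounts, so the first index where they differ persists;
    positivity at i keeps the truncated subtraction exact. *)
Lemma drl_gt_shift2 i j (a b : 'X_{1..n}) : (0 < a i)%N -> (0 < b i)%N -> drl_gt a b ->
  drl_gt (shift i j 1 a) (shift i j 1 b).
Proof.
move=> ai bi /drl_gtP[l ab h]; apply/drl_gtP; exists l => [|u /h e].
  rewrite !shiftE ltn_add2r; case: eqP => [e|_]; last by rewrite mul0n !subn0.
  by rewrite mul1n ltn_sub2r //; apply: leq_ltn_trans ab; rewrite -e.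
by rewrite !shiftE e.
Qed.

End Shift.

(** * Elementary substitutions *)

Section ElementarySubstitution.
Variables (R : comNzRingType) (n k : nat).
Variables (y y' : n.-tuple {mpoly R[k]}) (i j : 'I_n) (t : R).
Hypothesis ij : i != j.
Hypothesis y'i : tnth y' i = tnth y i + t *: tnth y j.
Hypothesis y'N : forall l, l != i -> tnth y' l = tnth y l.

Lemma comp_mpolyXD (m1 m2 : 'X_{1..n}) (z : n.-tuple {mpoly R[k]}) :
  'X_[m1 + m2] \mPo z = ('X_[m1] \mPo z) * ('X_[m2] \mPo z).
Proof. by rewrite mpolyXD rmorphM. Qed.

Lemma comp_mpolyXn (l : 'I_n) b (z : n.-tuple {mpoly R[k]}) :
  'X_[U_(l) *+ b] \mPo z = tnth z l ^+ b.
Proof. by rewrite -mpolyXn rmorphXn /= comp_mpolyXU -tnth_nth. Qed.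

(** Binomial expansion of [(y_i + t y_j) ^ (m i)]; the other factors of the monomial are
    untouched. *)
Lemma comp_elementary (m : 'X_{1..n}) :
  'X_[m] \mPo y' =
  \sum_(b < (m i).+1) ('C(m i, b)%:R * t ^+ b) *: ('X_[shift i j b m] \mPo y).
Proof.
pose m0 := (m - U_(i) *+ m i)%MM.
have m0E b : (b <= m i)%N -> (m - U_(i) *+ b = m0 + U_(i) *+ (m i - b))%MM.
  move=> hb; apply/mnmP => l; rewrite mnmDE !mnmBE !mulmnE mnm1E.
  by case: eqP => [<-|]; rewrite ?mul1n ?mul0n ?subnn ?add0n ?addn0.
have m0y : 'X_[m0] \mPo y' = 'X_[m0] \mPo y.
  rewrite !comp_mpolyX; apply: eq_bigr => l _.
  have [->|li] := eqVneq l i; last by rewrite y'N.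
  by rewrite mnmBE mulmnE mnm1E eqxx mul1n subnn !expr0.
(* [m0] is m stripped of [x_i]. The rewriting also affects the right-hand side, which is folded back
   once the power of [x_i] is expanded. *)
have -> : m = (m0 + U_(i) *+ m i)%MM.
  by have := m0E 0%N isT; rewrite mulm0n subm0 subn0.
rewrite comp_mpolyXD comp_mpolyXn y'i m0y exprDn mulr_sumr.
have -> : (m0 + U_(i) *+ m i)%MM = m.
  by have := m0E 0%N isT; rewrite mulm0n subm0 subn0.
apply: eq_bigr => b _; have hb : (b <= m i)%N by rewrite -ltnS.
rewrite /shift m0E // !comp_mpolyXD !comp_mpolyXn exprZn -scalerAr mulrnAr.
by rewrite -scalerAr mulrA -scalerA scaler_nat.
Qed.

End ElementarySubstitution.

Section GtildeElementary.
Variables n r : nat.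

Local Notation N := 'C(n + r, n).

Lemma gtilde1 : gtilde n r 1%:M = 1%:M.
Proof.
apply/matrixP => a c; rewrite !mxE.
have -> : [tuple \sum_m (1%:M : 'M[rat]_n.+1) l m *: 'X_m | l < n.+1] =
          [tuple 'X_l | l < n.+1] :> n.+1.-tuple {mpoly rat[n.+1]}.
  apply: eq_from_tnth => l; rewrite !tnth_mktuple (bigD1 l) //= mxE eqxx scale1r.
  rewrite big1 ?addr0 // => m ml; rewrite mxE eq_sym (negPf ml) scale0r.
  by [].
by rewrite comp_mpoly_id mcoeffX (inj_eq (@mon_inj n r)).
Qed.

(* Row a holds the coefficients of mon a under x_i |-> x_i + T x_j, where T is
   the polynomial variable. *)
Definition shift_mx (K : comNzRingType) (i j : 'I_n.+1) : 'M[{poly K}]_N :=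
  \matrix_(a, c) \sum_(b < (mon n r a i).+1)
     ((mon n r c == shift i j b (mon n r a)) * 'C(mon n r a i, b))%:R *: 'X^b.

(** Left multiplication by the elementary matrix adds t times row j of g to row i, so the image of
    [x_i] gains t times that of [x_j] and [comp_elementary] applies. *)
Lemma gtilde_elementary (i j : 'I_n.+1) (t : rat) (g : 'M[rat]_n.+1) : i != j ->
  gtilde n r ((1%:M + t *: delta_mx i j) *m g) =
  map_mx (horner_eval t) (shift_mx rat i j) *m gtilde n r g.
Proof.
move=> ij; apply/matrixP => a c; rewrite [LHS]mxE.
set y' := [tuple _ | _ < _]; pose y := [tuple \sum_m g l m *: 'X_m | l < n.+1].
rewrite (@comp_elementary _ _ _ y y' i j t) //; first last.
- move=> l li; rewrite !tnth_mktuple; apply: eq_bigr => m _; congr (_ *: _).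
  rewrite mulmxDl mul1mx -scalemxAl !mxE.
  rewrite big1 ?mulr0 ?addr0 // => u _.
  by rewrite !mxE (negPf li) mul0r.
- rewrite !tnth_mktuple scaler_sumr -big_split; apply: eq_bigr => m _ /=.
  rewrite scalerA -scalerDl; congr (_ *: _).
  rewrite mulmxDl mul1mx -scalemxAl !mxE; congr (_ + _ * _).
  rewrite (bigD1 j) //= !mxE !eqxx mul1r big1 ?addr0 // => u uj.
  by rewrite mxE (negPf uj) andbF mul0r.
rewrite raddf_sum mxE /=.
under [RHS]eq_bigr => e _ do rewrite !mxE /horner_eval horner_sum mulr_suml.
rewrite exchange_big; apply: eq_bigr => b _ /=.
have hb : (b <= mon n r a i)%N by rewrite -ltnS.
(* The shifted monomial still has degree r, hence is [mon e] for a single e, and only that index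
   contributes. *)
have [e he] : exists e, mon n r e = shift i j b (mon n r a).
  by apply: mon_surj; rewrite mdeg_shift // mdeg_mon.
rewrite (bigD1 e) //= !hornerE he eqxx mul1n mcoeffZ.
rewrite [X in _ + X]big1 ?addr0 // => u ue.
by rewrite -he (inj_eq (@mon_inj n r)) (negPf ue) mul0n scale0r horner0 mul0r.
Qed.

End GtildeElementary.

(** * Ranks and pivots *)

(** Lower semicontinuity of the rank: d is a determinant whose size s is the rank at 0, and it
    equals 1 at 0; wherever it is nonzero, the rank is at least s. *)
Lemma rank_horner_generic (K : fieldType) (a b : nat) (F : 'M[{poly K}]_(a, b)) :
  exists2 d : {poly K}, d != 0 & forall t, d.[t] != 0 ->
    (\rank (map_mx (horner_eval 0%R) F) <= \rank (map_mx (horner_eval t) F))%N.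
Proof.
set F0 := map_mx (horner_eval 0) F; set s := \rank F0.
(* U and V undo the Gaussian factorization of [F0] and cut out its identity block. *)
pose U : 'M[K]_(s, a) := pid_mx s *m invmx (col_ebase F0).
pose V : 'M[K]_(b, s) := invmx (row_ebase F0) *m pid_mx s.
have UFV : U *m F0 *m V = 1%:M.
  rewrite /U /V -{2}(mulmx_ebase F0) -/s !mulmxA mulmxKV ?col_ebase_unit //.
  rewrite mulmxK ?row_ebase_unit // !mul_pid_mx !minnn.
  by rewrite (minn_idPr (rank_leq_row F0)) minnn (minn_idPr (rank_leq_col F0)) pid_mx_1.
pose d := \det (map_mx polyC U *m F *m map_mx polyC V).
have dE t : d.[t] = \det (U *m map_mx (horner_eval t) F *m V).
  rewrite -[LHS]/(horner_eval t d) -det_map_mx !map_mxM -!map_mx_comp.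
  have mapK a' b' (X : 'M[K]_(a', b')) : map_mx (horner_eval t \o polyC) X = X.
    by apply/matrixP => i j; rewrite mxE /= /horner_eval hornerC.
  by rewrite !mapK.
exists d; first by apply: contra_eq_neq (dE 0) => ->; rewrite UFV det1 horner0 eq_sym oner_eq0.
move=> t; rewrite dE -unitfE -[_ \in _]/(_ \in unitmx) -row_full_unit => /eqP h.
rewrite -{1}h; apply: leq_trans (mxrankM_maxl _ _) _; exact: mxrankM_maxr.
Qed.

(** In characteristic 0 the integers from 1 to [size d] are distinct, one more than the degree
    allows as roots. *)
Lemma exists_nat_nonroot (K : fieldType) (d : {poly K}) :
  [pchar K] =i pred0 -> d != 0 -> exists2 t : nat, (0 < t)%N & d.[t%:R] != 0.
Proof.
move=> charK d0; pose rs := [seq t%:R : K | t <- iota 1 (size d)].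
have urs : uniq rs.
  rewrite map_inj_in_uniq ?iota_uniq // => u v _ _ /eqP.
  wlog uv : u v / (u <= v)%N => [h|].
    by case/orP: (leq_total u v) => [/h//|/h h']; rewrite eq_sym => /h'.
  rewrite eq_sym -subr_eq0 -natrB // (pcharf0P K).1 // subn_eq0 => vu.
  by apply/eqP; rewrite eqn_leq uv.
have /allPn[z /mapP[t]] : ~~ all (root d) rs.
  apply/negP => ars; have := max_poly_roots d0 ars urs.
  by rewrite size_map size_iota ltnn.
by rewrite mem_iota => /andP[t0 _] -> h; exists t.
Qed.

Section RowSpans.
Variables (K : fieldType) (N p : nat) (M : 'M[K]_(N, p)).

(* Left multiplication by [tail_mx R h] kills the rows of index less than h. *)
Definition tail_mx (R : pzSemiRingType) (h : nat) : 'M[R]_N :=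
  \matrix_(a, c) ((a == c) && (h <= a)%N)%:R.

Lemma mul_tail_mx (R : pzSemiRingType) q (B : 'M[R]_(N, q)) h a c :
  (tail_mx R h *m B) a c = if (h <= a)%N then B a c else 0.
Proof.
rewrite mxE (bigD1 a) //= mxE eqxx big1 ?addr0.
  by case: leqP => _; rewrite ?mul1r ?mul0r.
by move=> u; rewrite mxE eq_sym => /negPf->; rewrite mul0r.
Qed.

Lemma row_tail_mx (R : pzSemiRingType) q (B : 'M[R]_(N, q)) h a :
  row a (tail_mx R h *m B) = if (h <= a)%N then row a B else 0.
Proof.
by apply/rowP => c; rewrite mxE mul_tail_mx; case: ifP => _; rewrite mxE.
Qed.

Local Notation D := (tail_mx K).

Lemma tail_mx0 : D 0 *m M = M.
Proof. by apply/matrixP => a c; rewrite mul_tail_mx. Qed.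

Lemma tail_mxN : D N *m M = 0.
Proof. by apply/matrixP => a c; rewrite mul_tail_mx leqNgt ltn_ord mxE. Qed.

Definition pivot (a : 'I_N) := ~~ (row a M <= D a.+1 *m M)%MS.

Lemma tail_mxS (a : 'I_N) : (D a *m M :=: row a M + D a.+1 *m M)%MS.
Proof.
apply/eqmxP/andP; split.
  apply/row_subP => c; rewrite row_tail_mx; case: ifP => [ac|_]; last exact: sub0mx.
  have [->|/negPf ca] := eqVneq c a; first exact: addsmxSl.
  apply: submx_trans (addsmxSr _ _).
  have := row_sub c (D a.+1 *m M); rewrite row_tail_mx ltn_neqAle ac.
  by rewrite eq_sym (_ : _ == _ = false).
rewrite addsmx_sub; apply/andP; split.
  by have := row_sub a (D a *m M); rewrite row_tail_mx leqnn.
apply/row_subP => c; rewrite row_tail_mx; case: ifP => [ac|_]; last exact: sub0mx.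
by have := row_sub c (D a *m M); rewrite row_tail_mx ltnW.
Qed.

Lemma rank_tail_mxS (a : 'I_N) :
  \rank (D a *m M) = (\rank (D a.+1 *m M) + pivot a)%N.
Proof.
rewrite tail_mxS /pivot; have [ra|nra] /= := boolP (_ <= _)%MS.
  by rewrite addn0 (addsmx_idPr ra).
apply/eqP; rewrite eqn_leq addn1; apply/andP; split.
  apply: leq_trans (mxrank_adds_leqif _ _) _.
  by rewrite -[leqRHS]add1n leq_add2r rank_leq_row.
by apply: rank_ltmx; rewrite ltmxE addsmxSr addsmx_sub submx_refl andbT.
Qed.

(** Telescoping of [rank_tail_mxS], from the empty tail to the whole matrix. *)
Lemma card_pivot : #|pivot| = \rank M.
Proof.
have h k : (k <= N)%N -> \rank (D (N - k) *m M) = (\sum_(a < N | (N - k <= a)%N) pivot a)%N.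
  elim: k => [_|k IH lt].
    rewrite subn0 tail_mxN mxrank0 big1 // => a; rewrite leqNgt ltn_ord //.
  have e : (N - k = (N - k.+1).+1)%N by rewrite subnSK.
  have lt' : (N - k.+1 < N)%N by rewrite -e leq_subr.
  rewrite -[(N - k.+1)%N]/(nat_of_ord (Ordinal lt')) rank_tail_mxS /= -e IH ?(ltnW lt) //.
  rewrite [RHS](bigD1 (Ordinal lt')) ?leqnn //= addnC; congr (_ + _)%N.
  by apply: eq_bigl => a; rewrite e ltn_neqAle andbC eq_sym -val_eqE.
have := h N (leqnn N); rewrite subnn tail_mx0 => ->.
rewrite -sum1_card big_mkcond; apply: eq_bigr => a _.
by rewrite -[a \in _]/(pivot a); case: (pivot a).
Qed.

(** Going up from the last row: a row that is not a pivot lies in the span of later ones, already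
    known to be in B. *)
Lemma pivot_span q (B : 'M[K]_(q, p)) :
  (forall a, pivot a -> (row a M <= B)%MS) -> (M <= B)%MS.
Proof.
move=> hB; suff h k : (k <= N)%N -> (D (N - k) *m M <= B)%MS.
  by have := h N (leqnn N); rewrite subnn tail_mx0.
elim: k => [_|k IH lt]; first by rewrite subn0 tail_mxN sub0mx.
have e : (N - k = (N - k.+1).+1)%N by rewrite subnSK.
have lt' : (N - k.+1 < N)%N by rewrite -e leq_subr.
have {}IH := IH (ltnW lt).
rewrite -[(N - k.+1)%N]/(nat_of_ord (Ordinal lt')) tail_mxS addsmx_sub -e IH andbT.
have [//|] := boolP (pivot (Ordinal lt')); first exact: hB.
by rewrite /pivot negbK => /submx_trans; apply; rewrite -e.
Qed.

End RowSpans.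

(** * Galligo's theorem *)

(** The coefficients are natural numbers, so the substitutions over the rationals and over a residue
    field correspond. *)
Lemma map_shift_mx (K L : comNzRingType) (f : {rmorphism K -> L}) n r
    (i j : 'I_n.+1) (t : K) :
  map_mx f (map_mx (horner_eval t) (shift_mx r K i j)) =
  map_mx (horner_eval (f t)) (shift_mx r L i j).
Proof.
apply/matrixP => a c; rewrite !mxE /horner_eval !horner_sum rmorph_sum.
by apply: eq_bigr => b _; rewrite !hornerE rmorphM rmorph_nat rmorphXn.
Qed.

Section ImprovePivots.
Variables (K : fieldType) (n r p : nat).
Hypothesis charK : [pchar K] =i pred0.

Local Notation N := 'C(n + r, n).
Local Notation D := (tail_mx N K).

Variable M : 'M[K]_(N, p).
Variables (i j : 'I_n.+1) (a h : 'I_N).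
Hypothesis ij : (i < j)%N.
Hypothesis ai : (0 < mon n r a i)%N.
Hypothesis hE : mon n r h = shift i j 1 (mon n r a).
Hypothesis a_nonpivot : ~~ pivot M a.
Hypothesis h_pivot : pivot M h.

Let G := shift_mx r K i j.
(** [G1] is [(G - 1) / X]: the term b = 0 of [shift_mx] is the identity, whence the [b.+1]. Its
    value E at 0 is the matrix of the derivation [x_j d/dx_i]. *)
Let G1 : 'M[{poly K}]_N := \matrix_(u, c) \sum_(b < mon n r u i)
  ((mon n r c == shift i j b.+1 (mon n r u)) * 'C(mon n r u i, b.+1))%:R *: 'X^b.
Let E := map_mx (horner_eval 0) G1.

Let GE : G = 1%:M + 'X *: G1.
Proof.
apply/matrixP => u c; rewrite !mxE big_ord_recl shift0 bin0 muln1.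
rewrite (inj_eq (@mon_inj n r)) scaler_nat expr0 eq_sym; congr (_ + _).
rewrite mulr_sumr; apply: eq_bigr => b _.
by rewrite -scalerAr -exprS.
Qed.

Let map_GE t : map_mx (horner_eval t) G = 1%:M + t *: map_mx (horner_eval t) G1.
Proof. by rewrite GE map_mxD map_mx1 map_mxZ /= /horner_eval hornerX. Qed.

Let EE u c : E u c =
  if (0 < mon n r u i)%N && (mon n r c == shift i j 1 (mon n r u))
  then (mon n r u i)%:R else 0.
Proof.
rewrite !mxE /horner_eval horner_sum; case: ltnP => [ui|]; last first.
  by rewrite leqn0 => /eqP->; rewrite big_ord0.
rewrite (bigD1 (Ordinal ui)) //= !hornerE big1 ?addr0 => [|b b0].
  by case: (_ == _); rewrite ?mul0n // mul1n bin1.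
rewrite !hornerE expr0n (_ : (b == _ :> nat) = false) ?mulr0 //.
exact/negbTE.
Qed.

Lemma shift_lt : (h < a)%N.
Proof. by rewrite -drl_gt_mon hE drl_gt_shift. Qed.

(** By [drl_gt_shift2], E sends monomials after [mon a] to multiples of monomials after [mon h], so
    killing the columns up to h changes nothing. *)
Let tailE : D a.+1 *m E = D a.+1 *m E *m D h.+1.
Proof.
apply/matrixP => u c; rewrite mul_tail_mx [RHS]mxE.
rewrite (bigD1 c) //= [X in _ + X]big1 ?addr0; last first.
  by move=> v vc; rewrite [X in _ * X]mxE (negPf vc) mulr0.
rewrite mul_tail_mx [X in _ * X]mxE eqxx /=; case: ifP => [au|_]; last by rewrite mul0r.
rewrite EE; case: ifP => [/andP[ui /eqP cE]|_]; last by rewrite mul0r.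
rewrite -drl_gt_mon cE hE drl_gt_shift2 ?mulr1 //.
by rewrite drl_gt_mon.
Qed.

Let row_aE : row a E = (mon n r a i)%:R *: delta_mx 0 h.
Proof.
apply/rowP => c; rewrite [LHS]mxE EE ai -hE (inj_eq (@mon_inj n r)) !mxE eqxx /=.
by case: eqP; rewrite ?mulr1 ?mulr0.
Qed.

(** A natural t comes from a rational substitution; no tail may lose rank, so that the sum of the
    ranks grows strictly. *)
Lemma pivot_improve : exists t : nat, forall G',
  G' = map_mx (horner_eval t%:R) G ->
  (forall e : 'I_N.+1, \rank (D e *m M) <= \rank (D e *m (G' *m M)))%N /\
  (\rank (D h.+1 *m M) < \rank (D h.+1 *m (G' *m M)))%N.
Proof.
have [w wE] : exists w, row a M = w *m (D a.+1 *m M).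
  by apply/submxP; move: a_nonpivot; rewrite negbK.
(* Row a is a combination w of later rows; f is the resulting relation, with leading monomial
   [mon a]. *)
pose f : 'rV[K]_N := delta_mx 0 a - w *m D a.+1.
have fM : f *m M = 0 by rewrite mulmxBl -rowE wE mulmxA subrr.
(* f is supported on indices at least a, and these exceed h. *)
have fD : f = f *m D h.+1.
  apply/rowP => c; rewrite [RHS]mxE (bigD1 c) //= [X in _ + X]big1 ?addr0; last first.
    by move=> u uc; rewrite [X in _ * X]mxE (negPf uc) mulr0.
  rewrite [X in _ * X]mxE eqxx /=; case: ltnP => hc; rewrite ?mulr1 ?mulr0 //.
  have ca : (c < a)%N := leq_ltn_trans hc shift_lt.
  rewrite mxE [X in X + _]mxE [X in _ + X]mxE [X in - X]mxE -[c == a]val_eqE (ltn_eqF ca).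
  rewrite andbF sub0r big1 ?oppr0 //.
  move=> u _; rewrite [X in _ * X]mxE; case: eqP => [->|_]; last by rewrite mulr0.
  by rewrite ltnNge (ltnW ca) mulr0.
pose CM := map_mx polyC M.
have mapK t a' b' (X : 'M[K]_(a', b')) : map_mx (horner_eval t) (map_mx polyC X) = X.
  by apply/matrixP => u v; rewrite !mxE /= /horner_eval hornerC.
pose F e := map_mx polyC (D e) *m G *m CM.
have FE e t : map_mx (horner_eval t) (F e) =
    D e *m (map_mx (horner_eval t) G *m M).
  by rewrite !map_mxM !mapK mulmxA.
have F0 e : map_mx (horner_eval 0) (F e) = D e *m M.
  by rewrite FE map_GE scale0r addr0 mul1mx.
(* The added row is [f G M] divided by the variable, possible since [f M = 0]. At 0 it is [f E M],
   which supplies row h; at t nonzero it already lies in the tail of the transformed matrix. *)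
pose H := col_mx (F h.+1) (map_mx polyC f *m G1 *m CM).
have HE t : map_mx (horner_eval t) H = col_mx (D h.+1 *m (map_mx (horner_eval t) G *m M))
    (f *m map_mx (horner_eval t) G1 *m M).
  by rewrite map_col_mx FE !map_mxM !mapK.
have H0 : (\rank (D h *m M) <= \rank (map_mx (horner_eval 0) H))%N.
  apply: mxrankS; rewrite HE -FE F0 tail_mxS addsmx_sub -!addsmxE addsmxSl andbT.
  have mi0 : (mon n r a i)%:R != 0 :> K by rewrite (pcharf0P K).1 // -lt0n.
  rewrite -(eqmx_scale _ mi0).
  (* The derivation applied to f is a nonzero multiple of [mon h] minus terms after h; the latter
     are added back and lie in the tail of M. *)
  have -> : (mon n r a i)%:R *: row h M = f *m E *m M + w *m D a.+1 *m E *m (D h.+1 *m M).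
    rewrite mulmxBl -rowE row_aE -!mulmxA tailE mulmxBl !mulmxA subrK.
    by rewrite -scalemxAl -rowE.
  by rewrite addrC addmx_sub_adds ?submxMl // submx_refl.
have dimprove (e : 'I_N.+1) : exists2 d : {poly K}, d != 0 &
    forall t, d.[t] != 0 -> (\rank (D e *m M) <=
      \rank (D e *m (map_mx (horner_eval t) G *m M)))%N.
  have [d d0 dP] := rank_horner_generic (F e); exists d => // t /dP.
  by rewrite F0 FE.
have [d d0 dP] := fin_all_exists2 dimprove.
have [d' d'0 d'P] := rank_horner_generic H.
have [|t t0] := @exists_nat_nonroot K (d' * \prod_e d e) charK.
  by rewrite mulf_neq0 //; apply/prodf_neq0.
rewrite hornerM horner_prod mulf_eq0 negb_or => /andP[d't /prodf_neq0 dt].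
exists t => G' ->; split=> [e|]; first exact: dP (dt e isT).
(* As h is a pivot, the tail of M from h has rank one more than the tail after h. *)
rewrite -[leqLHS]addn1; have := rank_tail_mxS M h; rewrite h_pivot => <-.
apply: leq_trans H0 (leq_trans (d'P _ d't) _); rewrite HE.
apply: mxrankS; rewrite -addsmxE addsmx_sub submx_refl /=.
have t0' : t%:R != 0 :> K by rewrite (pcharf0P K).1 // -lt0n.
rewrite -(eqmx_scale _ t0') scalemxAl scalemxAr.
(* [f M = 0] gives [f (t G1) M = f (1 + t G1) M], and [f = f D] inserts the tail matrix. *)
have -> : f *m (t%:R *: map_mx (horner_eval t%:R) G1) *m M =
    f *m (D h.+1 *m (map_mx (horner_eval t%:R) G *m M)).
  by rewrite mulmxA -fD map_GE mulmxDl mulmxDr mul1mx fM add0r mulmxA.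
exact: submxMl.
Qed.
End ImprovePivots.

Section StablePivots.
Variables (K : fieldType) (n r p : nat) (sigma : {rmorphism rat -> K}).

Local Notation N := 'C(n + r, n).

Variable Q : 'M[K]_(N, p).
Hypothesis rankQ : \rank Q = p.

Let charK : [pchar K] =i pred0.
Proof. by move=> c; rewrite (fmorph_pchar sigma) Num.Theory.pchar_num. Qed.

Let M g := map_mx sigma (gtilde n r g) *m Q.
Let total (B : 'M[K]_(N, p)) := (\sum_(e < N.+1) \rank (tail_mx N K e *m B))%N.

Lemma exists_borel_pivots : exists g, [/\ g \in unitmx,
  \rank (map_mx sigma (gtilde n r g) *m Q) = p &
  forall (i j : 'I_n.+1) (a h : 'I_N), (i < j)%N -> (0 < mon n r a i)%N ->
    mon n r h = shift i j 1 (mon n r a) ->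
    ~~ pivot (map_mx sigma (gtilde n r g) *m Q) a ->
    ~~ pivot (map_mx sigma (gtilde n r g) *m Q) h].
Proof.
(* Values of the sum to be maximized; each of its N + 1 terms is at most p. *)
pose good v := `[< exists g, [/\ g \in unitmx, \rank (M g) = p & total (M g) = v] >].
have good1 : exists v, good v.
  exists (total (M 1%:M)); apply/asboolP; exists 1%:M; split=> //.
    exact: unitmx1.
  by rewrite /M gtilde1 map_mx1 mul1mx.
have bound v : good v -> (v <= N.+1 * p)%N.
  move=> /asboolP[g [_ _ <-]].
  rewrite -[X in (X * _)%N]card_ord -sum_nat_const; apply: leq_sum => e _.
  exact: rank_leq_col.
case: (ex_maxnP good1 bound) => v /asboolP[g [ug rg tg]] max_v.
exists g; split=> // i j a h ij ai hE npa; apply/negP => ph.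
have [t /(_ _ erefl)[le lt]] := pivot_improve charK ij ai hE npa ph.
have ij' : i != j by rewrite -val_eqE (ltn_eqF ij).
pose g' := (1%:M + t%:R *: delta_mx i j) *m g.
have Mg' : M g' = map_mx (horner_eval t%:R) (shift_mx r K i j) *m M g.
  by rewrite /M gtilde_elementary // map_mxM map_shift_mx rmorph_nat mulmxA.
have good' : good (total (M g')).
  apply/asboolP; exists g'; split=> //.
    rewrite unitmx_mul ug andbT.
    (* [delta_mx i j] squares to zero as i != j, so changing the sign of t gives the inverse. *)
    suff : (1%:M + t%:R *: delta_mx i j) *m (1%:M - t%:R *: delta_mx i j) = 1%:M :> 'M[rat]_n.+1.
      by move/mulmx1_unit => [].
    rewrite mulmxBr mulmx1 mulmxDl mul1mx -scalemxAl -scalemxAr mul_delta_mx_0 1?eq_sym //.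
    by rewrite !scaler0 addr0 addrK.
  apply/eqP; rewrite eqn_leq rank_leq_col -[leqLHS]rg Mg'.
  (* The tail from 0 is the whole matrix, so full rank is preserved. *)
  by have := le ord0; rewrite !tail_mx0.
have := max_v _ good'; apply/negP; rewrite -ltnNge -tg.
(* The tail after h has index h + 1, which may be N; hence the sum runs over N + 1 indices. *)
have lt_h : (h.+1 < N.+1)%N by rewrite ltnS.
rewrite /total (bigD1 (Ordinal lt_h)) //= [ltnRHS](bigD1 (Ordinal lt_h)) //=.
rewrite -addSn leq_add //; first by rewrite Mg'.
by apply: leq_sum => e _; rewrite Mg'.
Qed.

Lemma exists_borel_minor : exists (I : p.-tuple 'I_N) (g : 'M[rat]_n.+1),
  [/\ sorted (fun i j => (i < j)%N) (map val I), g \in unitmx,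
      forall (i j : 'I_n.+1) (a h : 'I_N), (i < j)%N -> (0 < mon n r a i)%N ->
        mon n r h = shift i j 1 (mon n r a) -> a \notin I -> h \notin I
    & Gamma K N p I *m map_mx sigma (gtilde n r g) *m Q \in unitmx].
Proof.
have [g [ug rg hg]] := exists_borel_pivots.
have sz : size (enum (pivot (M g))) == p by rewrite -cardE card_pivot rg.
have inE a : (a \in enum (pivot (M g))) = pivot (M g) a by rewrite mem_enum.
exists (Tuple sz), g; split=> //.
- rewrite /= {1}/enum_mem -enumT; apply: (subseq_sorted ltn_trans (s2 := iota 0 N)).
    by rewrite -val_enum_ord; apply/map_subseq/filter_subseq.
  exact: iota_ltn_sorted.
- by move=> i j a h ij ai hE; rewrite [_ \in _]inE [_ \in Tuple _]inE; apply: hg hE.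
(* The pivot rows span the row space of [M g], which is everything because the rank is p. *)
- rewrite -row_full_unit -sub1mx -mulmxA -/(M g).
  apply: (submx_trans (B := M g)).
    by rewrite sub1mx /row_full rg.
  apply: pivot_span => a; rewrite -inE => ha.
  have lt : (index a (enum (pivot (M g))) < p)%N by rewrite -[ltnRHS](eqP sz) index_mem.
  have -> : row a (M g) = row (Ordinal lt) (Gamma K N p (Tuple sz) *m M g).
    rewrite row_mul rowE; congr (_ *m _); apply/rowP => c; rewrite !mxE eqxx /=.
    by rewrite (tnth_nth a) /= nth_index.
  exact: row_sub.
Qed.

End StablePivots.

(** * Borel-fixed monomial ideals *)

Lemma smallest_ideal (A : comPzRingType) (G : set A) :
  ideal (smallest (@ideal A) G).
Proof.
split=> [J [[J0 _ _] _] //|a b ha hb J hJ|c a ha J hJ].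
  by have [[_ JD _] _] := hJ; apply: JD; [apply: ha|apply: hb].
by have [[_ _ JM] _] := hJ; apply: JM; apply: ha.
Qed.

(** Supports grow under sums and products only by multiples of old monomials, so the right-hand side
    is an ideal; conversely every term of such an f is a multiple of a generator. *)
Lemma monomial_idealE (k : fieldType) (n : nat) (S : set 'X_{1..n}) :
  smallest (@ideal {mpoly k[n]}) [set 'X_[m] | m in S] =
  [set f | forall m, m \in msupp f -> exists2 s, S s & (s <= m)%MM].
Proof.
apply/seteqP; split=> [|f /=].
  apply: smallest_sub.
    split=> [m|f1 f2 h1 h2 m|c f1 h m]; first by rewrite msupp0.
      by move=> /msuppD_le; rewrite mem_cat => /orP[/h1|/h2].
    move=> /msuppM_le/allpairsP[[m1 m2] /= [_ /h[s hs le] ->]].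
    by exists s => //; apply: (lepm_trans le); apply: lem_addl.
  by move=> _ [m hm <-] m'; rewrite msuppX inE => /eqP->; exists m; rewrite ?lepm_refl.
move=> h J [[J0 JD JM] hJ]; rewrite (mpolyE f) big_seq.
apply: (big_ind J) => // m /h[s hs le]; rewrite -mul_mpolyC; apply: (JM _ _); rewrite -(submK le).
by rewrite mpolyXD; apply: JM; apply: hJ; exists s.
Qed.

Section BorelIdeal.
Variables (k : fieldType) (n r p : nat).

Local Notation N := 'C(n + r, n).

Variable I : p.-tuple 'I_N.

Lemma JJE : JJ k n r p I = [set f | forall m, m \in msupp f ->
  exists2 s, (exists2 a, a \notin I & mon n r a = s) & (s <= m)%MM].
Proof.
rewrite -monomial_idealE /JJ; congr (smallest _ _); apply/seteqP.
split=> [_ [a aI <-]|_ [_ [a aI <-] <-]].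
  by exists (mon n r a) => //; exists a.
by exists a.
Qed.

Lemma JJ_X m : JJ k n r p I 'X_[m] <->
  exists2 a, a \notin I & (mon n r a <= m)%MM.
Proof.
rewrite JJE /=; split=> [/(_ m)|[a aI le] m'].
  by rewrite msuppX inE eqxx => /(_ isT) [_ [a aI <-]]; exists a.
by rewrite msuppX inE => /eqP->; exists (mon n r a) => //; exists a.
Qed.

Hypothesis I_sorted : sorted (fun i j => (i < j)%N) (map val I).
Hypothesis I_stable : forall (i j : 'I_n.+1) (a h : 'I_N), (i < j)%N ->
  (0 < mon n r a i)%N -> mon n r h = shift i j 1 (mon n r a) ->
  a \notin I -> h \notin I.

(** It suffices to move generators: if the generator dividing m involves [x_i], its shift divides
    the new monomial; otherwise the generator itself still does. *)
Lemma strongly_stable_JJ : strongly_stable (JJ k n r p I).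
Proof.
split.
- exact: smallest_ideal.
- move=> f m; rewrite JJE => /= h mf m'; rewrite msuppX inE => /eqP->; exact: h.
move=> m i j /JJ_X[a aI le] mi ij; apply/JJ_X.
have ij' : i != j by rewrite -val_eqE (ltn_eqF ij).
have [ai|] := ltnP 0 (mon n r a i); last first.
  rewrite leqn0 => /eqP ai; exists a => //; apply/mnm_lepP => l.
  rewrite mnmDE mnmBE !mnm1E; have /mnm_lepP/(_ l) := le.
  case: eqP => [<-|_] h; first by rewrite ai.
  by rewrite subn0 (leq_trans h) ?leq_addr.
have [h hE] : exists h, mon n r h = shift i j 1 (mon n r a).
  by apply: mon_surj; rewrite mdeg_shift // mdeg_mon.
exists h; first exact: I_stable hE aI.
rewrite hE; apply/mnm_lepP => l; rewrite shiftE mnmDE mnmBE !mnm1E !muln1.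
by rewrite leq_add2r leq_sub2r //; move/mnm_lepP: le.
Qed.

Lemma borel_JJ : BB k n r (N - p) (JJ k n r p I).
Proof.
split; first exact: strongly_stable_JJ.
exists [seq mon n r a | a <- enum [predC I]]; first split.
- by rewrite map_inj_uniq ?enum_uniq //; apply: mon_inj.
- rewrite size_map -cardE -[X in (X - _)%N]card_ord -(cardC (mem I)).
  have -> : #|mem I| = p.
    have /card_uniqP -> : uniq I by apply/(map_uniq (f := val))/(sorted_uniq ltn_trans ltnn).
    exact: size_tuple.
  by rewrite addKn.
- by apply/allP => _ /mapP[a _ ->]; rewrite mdeg_mon.
- rewrite /JJ; congr (smallest _ _); apply/seteqP; split=> [_ [a aI <-]|_ [_ /mapP[a + ->] <-]].
    exists (mon n r a) => //=.
    by apply/mapP; exists a => //; rewrite mem_enum.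
  by rewrite mem_enum => aI; exists a.
Qed.

End BorelIdeal.

(** * The cover of the Grassmann functor *)

Lemma submodule_sum (A : comPzRingType) N (L : set 'rV[A]_N) (T : finType)
    (F : T -> 'rV[A]_N) :
  submodule L -> (forall x, L (F x)) -> L (\sum_x F x).
Proof. by case=> L0 LD _ h; apply: (big_ind L). Qed.

Lemma submoduleB (A : comPzRingType) N (L : set 'rV[A]_N) v w :
  submodule L -> L v -> L w -> L (v - w).
Proof.
by case=> _ LD LZ hv hw; apply: LD => //; rewrite -scaleN1r; apply: LZ.
Qed.

Definition mxker (A : comPzRingType) N p (Q : 'M[A]_(N, p)) : set 'rV[A]_N :=
  [set v | v *m Q = 0].

Lemma submodule_mxker (A : comPzRingType) N p (Q : 'M[A]_(N, p)) :
  submodule (mxker Q).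
Proof.
split=> [|v w hv hw|c v hv]; rewrite /mxker /=; first exact: mul0mx.
  by rewrite mulmxDl hv hw addr0.
by rewrite -scalemxAl hv scaler0.
Qed.

Lemma free_quotient_mxker (A : comPzRingType) N p (b : 'M[A]_(p, N))
    (Q : 'M[A]_(N, p)) : b *m Q = 1%:M -> free_quotient p (mxker Q).
Proof.
move=> bQ; exists b; split=> [v|c]; last by rewrite /mxker /= -mulmxA bQ mulmx1.
by exists (v *m Q); rewrite /mxker /= mulmxBl -!mulmxA bQ mulmx1 subrr.
Qed.

(** The rows of Q are the coordinates of the standard basis vectors modulo L, so [v - v Q b] is in L
    for all v; freeness of b then gives both claims. *)
Lemma free_quotient_coords (A : comPzRingType) N p (L : set 'rV[A]_N) :
  submodule L -> free_quotient p L ->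
  exists (b : 'M[A]_(p, N)) (Q : 'M[A]_(N, p)), b *m Q = 1%:M /\ L = mxker Q.
Proof.
move=> subL [b [b_span b_free]].
have [q qP] := fin_all_exists (fun i : 'I_N => b_span (delta_mx 0 i)).
pose Q : 'M[A]_(N, p) := \matrix_i q i.
have LQ v : L (v - v *m Q *m b).
  have -> : v - v *m Q *m b = \sum_i v 0 i *: (delta_mx 0 i - q i *m b).
    rewrite {1}(row_sum_delta v) -mulmxA mulmx_sum_row -sumrB.
    by apply: eq_bigr => i _; rewrite row_mul rowK scalerBr.
  apply: (submodule_sum subL) => i; case: subL => _ _; apply; exact: qP.
exists b, Q; split.
  apply/row_matrixP => i; rewrite row_mul; apply/eqP; rewrite -subr_eq0 -oppr_eq0 opprB.
  apply/eqP/b_free; rewrite mulmxBl row1 -rowE; exact: LQ.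
apply/seteqP; split=> v; rewrite /mxker /=.
  move=> Lv; apply: b_free; rewrite -[_ *m b](subKr v); exact: submoduleB.
by move=> vQ; have := LQ v; rewrite vQ mul0mx subr0.
Qed.

(** The kernel of a split surjection commutes with base change: a vector killed by Q equals
    [v (1 - Q b)], and the rows of [1 - Q b] are in the kernel over A. *)
Lemma base_change_mxker (A B : comPzRingType) (phi : {rmorphism A -> B}) N p
    (b : 'M[A]_(p, N)) (Q : 'M[A]_(N, p)) :
  b *m Q = 1%:M -> base_change phi (mxker Q) = mxker (map_mx phi Q).
Proof.
move=> bQ; apply/seteqP; split.
  apply: smallest_sub; first exact: submodule_mxker.
  by move=> _ [v vQ <-]; rewrite /mxker /= -map_mxM vQ map_mx0.
move=> v vQ L [subL hL].
have -> : v = \sum_i v 0 i *: map_mx phi (delta_mx 0 i - row i Q *m b).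
  have vQb : v *m map_mx phi Q *m map_mx phi b = 0 by rewrite vQ mul0mx.
  rewrite {1}(row_sum_delta v) -[LHS]subr0 -[X in _ - X]vQb.
  rewrite -mulmxA mulmx_sum_row -sumrB; apply: eq_bigr => i _.
  by rewrite map_mxB map_delta_mx map_mxM scalerBr row_mul map_row.
apply: (submodule_sum subL) => i; case: subL => _ _; apply; apply: hL.
exists (delta_mx 0 i - row i Q *m b) => //.
by rewrite /mxker /= mulmxBl -mulmxA bQ mulmx1 -rowE subrr.
Qed.

Lemma submodule_base_change (A B : comPzRingType) (phi : {rmorphism A -> B}) N
    (L : set 'rV[A]_N) : submodule (base_change phi L).
Proof.
split=> [J [[J0 _ _] _] //|v w hv hw J hJ|c v hv J hJ].
  by have [[_ JD _] _] := hJ; apply: JD; [apply: hv|apply: hw].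
by have [[_ _ JZ] _] := hJ; apply: JZ; apply: hv.
Qed.

Lemma sub_base_change (A B : comPzRingType) (phi : {rmorphism A -> B}) N
    (L : set 'rV[A]_N) v : L v -> base_change phi L (map_mx phi v).
Proof. by move=> Lv J [_ hJ]; apply: hJ; exists v. Qed.

Lemma base_change_comp (A B C : comPzRingType) (phi : {rmorphism A -> B})
    (psi : {rmorphism B -> C}) N (L : set 'rV[A]_N) :
  base_change psi (base_change phi L) = base_change (psi \o phi) L.
Proof.
have [L0 LD LZ] := submodule_base_change (psi \o phi) L.
apply/seteqP; split; apply: smallest_sub; try exact: submodule_base_change.
  move=> _ [v hv <-]; move: v hv.
  apply: (@smallest_sub _ _ _ [set w | base_change (psi \o phi) L (map_mx psi w)]).
    split=> [|v w /= hv hw|c v /= hv]; first by rewrite /= map_mx0.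
      by rewrite map_mxD; apply: LD.
    by rewrite map_mxZ; apply: LZ.
  move=> _ [v hv <-] /=; rewrite -map_mx_comp; exact: sub_base_change.
move=> _ [v hv <-]; rewrite map_mx_comp.
by apply: sub_base_change; apply: sub_base_change.
Qed.

Section CoverGrassmannian.
Variables (k : fieldType) (n r p : nat).

Local Notation N := 'C(n + r, n).

(** The adjugate times u inverts the p by p matrix, which yields the required preimage of v. *)
Lemma mxker_GG (I : p.-tuple 'I_N) (g : 'M[rat]_n.+1) (A : comPzRingType)
    (iota : {rmorphism k -> A}) (b : 'M[A]_(p, N)) (Q : 'M[A]_(N, p)) u :
  b *m Q = 1%:M ->
  \det (Gamma A N p I *m map_mx (iota \o ratr) (gtilde n r g) *m Q) * u = 1 ->
  GG k n r p I g A iota (mxker Q).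
Proof.
move=> bQ detu; split.
- exact: submodule_mxker.
- exact: free_quotient_mxker bQ.
- set G := Gamma A N p I *m _ in detu; set X := G *m Q in detu.
  have adjX : (u *: \adj X) *m X = 1%:M.
    by rewrite -scalemxAl mul_adj_mx scale_scalar_mx mulrC detu.
  move=> v; exists (v *m Q *m (u *: \adj X)).
  rewrite -[_ *m map_mx _ _]mulmxA -/G /mxker /= mulmxBl -[X in _ - X]mulmxA.
  by rewrite -[G *m Q]/X -mulmxA adjX mulmx1 subrr.
Qed.

End CoverGrassmannian.

(** * The embedding of the rationals in a field of characteristic 0 *)

Section Char0Rational.
Variables (k : fieldType) (chark : [pchar k] =i pred0).

(* [ratr] is only known to be a morphism into ordered fields. *)
Definition char0_ratr of [pchar k] =i pred0 : rat -> k := ratr.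
Local Notation rat_to := (char0_ratr chark).

Let intr_neq0 (z : int) : z != 0 -> z%:~R != 0 :> k.
Proof.
case: z => m; first by rewrite -lt0n => m0; rewrite (pcharf0P k).1 // -lt0n.
by move=> _; rewrite NegzE mulrNz oppr_eq0 -pmulrn (pcharf0P k).1.
Qed.

(** Allows fractions that are not reduced, such as those that arise from sums and products. *)
Let rat_toE (x : rat) (a d : int) : d != 0 -> x * d%:~R = a%:~R ->
  rat_to x * d%:~R = a%:~R.
Proof.
move=> d0 e; rewrite /char0_ratr /ratr.
have dx : (denq x)%:~R != 0 :> k by rewrite intr_neq0 // denq_neq0.
apply: (mulIf dx); rewrite mulrAC divfK // -!intrM; congr (_%:~R).
have nx : (numq x)%:~R = x * (denq x)%:~R.
  by rewrite -{2}[x]divq_num_den divfK // intr_eq0 denq_neq0.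
by apply: (@intr_inj rat); rewrite !intrM -e nx mulrAC.
Qed.

Let num_denE (x : rat) : x * (denq x)%:~R = (numq x)%:~R.
Proof. by rewrite -{1}[x]divq_num_den divfK // intr_eq0 denq_neq0. Qed.

Let rat_to_num_den (x : rat) : rat_to x * (denq x)%:~R = (numq x)%:~R.
Proof. by apply: rat_toE => //; apply: denq_neq0. Qed.

Let den_neq0 (x y : rat) : denq x * denq y != 0.
Proof. by rewrite mulf_neq0 ?denq_neq0. Qed.

Lemma char0_ratr_zmod : zmod_morphism rat_to.
Proof.
move=> x y; apply: (mulIf (intr_neq0 (den_neq0 x y))).
rewrite (@rat_toE _ (numq x * denq y - numq y * denq x)) //.
  by rewrite intrB !intrM -!rat_to_num_den; ring.
by rewrite intrB !intrM -!num_denE; ring.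
Qed.

Lemma char0_ratr_monoid : monoid_morphism rat_to.
Proof.
split=> [|x y]; first by rewrite /char0_ratr /ratr divr1.
apply: (mulIf (intr_neq0 (den_neq0 x y))).
rewrite (@rat_toE _ (numq x * numq y)) //.
  by rewrite !intrM -!rat_to_num_den; ring.
by rewrite !intrM -!num_denE; ring.
Qed.

HB.instance Definition _ :=
  GRing.isZmodMorphism.Build rat k rat_to char0_ratr_zmod.
HB.instance Definition _ :=
  GRing.isMonoidMorphism.Build rat k rat_to char0_ratr_monoid.

End Char0Rational.

Lemma map_Gamma (A B : comPzRingType) (f : {rmorphism A -> B}) N p
    (I : p.-tuple 'I_N) : map_mx f (Gamma A N p I) = Gamma B N p I.
Proof. by apply/matrixP => i j; rewrite !mxE rmorph_nat. Qed.

(** Over the residue field of P the relation [b Q = 1] keeps Q of rank p; a minor that is nonzero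
    there lies outside P. *)
Lemma exists_borel_minor_prime (k : fieldType) (n r p : nat) (A : comPzRingType)
    (iota : {rmorphism k -> A}) (b : 'M[A]_(p, 'C(n + r, n)))
    (Q : 'M[A]_('C(n + r, n), p)) (P : set A) :
  [pchar k] =i pred0 -> prime_ideal P -> b *m Q = 1%:M ->
  exists c : borel_index k n r p,
    ~ P (\det (Gamma A _ p (bi_set c) *m
              map_mx (iota \o ratr) (gtilde n r (bi_mat c)) *m Q)).
Proof.
move=> chark hP bQ; have [K [kappa [kappa0 _]]] := prime_residue_field hP.
pose sigma : {rmorphism rat -> K} := kappa \o (iota \o char0_ratr chark).
have rankQ : \rank (map_mx kappa Q) = p.
  apply/eqP; rewrite eqn_leq rank_leq_col -[leqLHS](mxrank1 K p).
  by rewrite -(map_mx1 kappa) -bQ map_mxM mxrankM_maxr.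
have [I [g [sI ug stI unitX]]] := exists_borel_minor sigma rankQ.
exists (BorelIndex sI ug (borel_JJ k sI stI)) => /=.
move/kappa0; rewrite -det_map_mx !map_mxM map_Gamma -map_mx_comp => /eqP.
by apply/negP; rewrite -unitfE.
Qed.

(** Up to a power of the unit f, d is the image of a, so inverting f and then d amounts to inverting
    [f * a]. *)
Lemma localization_away_comp (A B C : comPzRingType) (phi : {rmorphism A -> B})
    (psi : {rmorphism B -> C}) f d a m :
  localization_away f phi -> localization_away d psi -> phi f ^+ m * d = phi a ->
  localization_away (f * a) (psi \o phi).
Proof.
move=> [[u hu] surj_phi ker_phi] [[v hv] surj_psi ker_psi] e.
have ea l : phi a ^+ l = phi f ^+ (m * l) * d ^+ l by rewrite -e exprMn exprM.
split=> [|c|x] /=.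
- exists (psi u ^+ m.+1 * v); rewrite rmorphM -e !rmorphM rmorphXn /=.
  have -> : psi (phi f) * (psi (phi f) ^+ m * psi d) * (psi u ^+ m.+1 * v) =
            (psi (phi f) * psi u) ^+ m.+1 * (psi d * v).
    by rewrite exprMn !exprS; ring.
  by rewrite hv -rmorphM hu rmorph1 expr1n mulr1.
- have [b [l el]] := surj_psi c; have [x [j ej]] := surj_phi b.
  (* With [d^l c = b] and [f^j b = x], multiplying c by [(f a)^(l + j)] gives this numerator, as
     [a^l = f^(m l) d^l] in B. *)
  exists (f ^+ l * a ^+ j * f ^+ (m * l) * x), (l + j)%N.
  have h : psi (phi a) ^+ l * c = psi (phi f ^+ (m * l)) * psi b.
    by rewrite -rmorphXn ea rmorphM -mulrA [psi (d ^+ l)]rmorphXn el.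
  rewrite !rmorphM -ej !rmorphXn !rmorphM !rmorphXn !exprMn !exprD /=.
  rewrite rmorphXn in h.
  transitivity (psi (phi f) ^+ l * psi (phi f) ^+ j * psi (phi a) ^+ j *
     (psi (phi a) ^+ l * c)); first by ring.
  by rewrite h; ring.
- move=> /ker_psi[l el]; have [j ej] : exists j, f ^+ j * (a ^+ l * x) = 0.
    by apply: ker_phi; rewrite rmorphM rmorphXn ea -mulrA el mulr0.
  exists (l + j)%N; rewrite exprMn !exprD.
  transitivity (f ^+ l * a ^+ j * (f ^+ j * (a ^+ l * x))); first by ring.
  by rewrite ej mulr0.
Qed.

(** * Extension of a prime to a localization *)

Section ExtendPrime.
Variables (A B : comPzRingType) (phi : {rmorphism A -> B}) (f : A) (P : set A).
Hypothesis loc : localization_away f phi.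
Hypothesis hP : prime_ideal P.
Hypothesis Pf : ~ P f.

Definition extend_prime : set B :=
  [set b | exists a m, P a /\ phi f ^+ m * b = phi a].

Let PX m : ~ P (f ^+ m).
Proof.
case: (hP) => _ P1 PM; elim: m => [//|m IH]; rewrite exprS => /PM[]; [exact: Pf|exact: IH].
Qed.

(** Any numerator of b may be tested: two of them agree up to powers of f, which lie outside P. *)
Lemma extend_primeE a m b : phi f ^+ m * b = phi a -> extend_prime b <-> P a.
Proof.
move=> e; split=> [[a' [m' [Pa' e']]]|Pa]; last by exists a, m.
case: (hP) => [[P0 PD PM] _ PP]; case: (loc) => _ _ ker.
have [j ej] : exists j, f ^+ j * (f ^+ m' * a - f ^+ m * a') = 0.
  by apply: ker; rewrite rmorphB !rmorphM !rmorphXn -e -e' mulrCA subrr.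
have : P (f ^+ j * (f ^+ m' * a)).
  have -> : f ^+ j * (f ^+ m' * a) = f ^+ j * (f ^+ m * a').
    by apply/eqP; rewrite -subr_eq0 -mulrBr ej.
  by apply/PM/PM.
by case/PP => [/PX//|/PP[/PX//|]].
Qed.

Lemma prime_extend_prime : prime_ideal extend_prime.
Proof.
case: (hP) => [[P0 PD PM] P1 PP]; case: (loc) => _ surj _; split.
- split=> [|b c [x [m [Px ex]]] [y [l [Py ey]]]|c b [x [m [Px ex]]]].
  + by exists 0, 0%N; rewrite mulr0 rmorph0.
  + exists (f ^+ l * x + f ^+ m * y), (m + l)%N; split; first by apply: PD; apply: PM.
    by rewrite rmorphD !rmorphM !rmorphXn -ex -ey exprD; ring.
  + have [y [l ey]] := surj c; exists (y * x), (l + m)%N; split; first exact: PM.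
    by rewrite rmorphM -ex -ey exprD; ring.
- by rewrite (@extend_primeE 1 0%N) ?rmorph1 ?mulr1.
- move=> b c; have [x [m ex]] := surj b; have [y [l ey]] := surj c.
  rewrite (extend_primeE ex) (extend_primeE ey) (@extend_primeE (x * y) (m + l)%N).
    exact: PP.
  by rewrite rmorphM -ex -ey exprD; ring.
Qed.

End ExtendPrime.

(** Two localizations: f makes the quotient free, then d inverts the minor. The numerator a of d
    avoids P because d avoids its extension. *)
Lemma borel_GG_cover (k : fieldType) (n r p : nat) : [pchar k] =i pred0 ->
  covers (Gr k p 'C(n + r, n))
    (fun c : borel_index k n r p => GG k n r p (bi_set c) (bi_mat c)).
Proof.
move=> chark A iota _ L [subL locL] P hP.
have [f Pf [B [phi [loc free]]]] := locL P hP.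
have [b [Q [bQ LE]]] := free_quotient_coords (submodule_base_change phi L) free.
have hPB := prime_extend_prime loc hP Pf.
have [c Pd] := exists_borel_minor_prime (phi \o iota) chark hPB bQ.
set d := \det _ in Pd; have [_ surj _] := loc; have [a [m e]] := surj d.
have [C [psi locpsi]] := exists_localization_away d.
have Pa : ~ P a by rewrite -(extend_primeE loc hP Pf e).
exists (f * a); first by case: hP => _ _ PM /PM[].
exists C, (psi \o phi); split; first exact: localization_away_comp loc locpsi e.
exists c; rewrite -base_change_comp LE (base_change_mxker psi bQ).
have [[u hu] _ _] := locpsi.
apply: (@mxker_GG _ _ _ _ _ _ _ _ (map_mx psi b) _ u).
  by rewrite -map_mxM bQ map_mx1.
by rewrite -hu -det_map_mx !map_mxM map_Gamma -map_mx_comp.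
Qed.

(** * The spectrum of a field *)

Section Point.
Variables (k K : fieldType) (iota : {rmorphism k -> K}).

Definition one_point : Type := unit.
HB.instance Definition _ := Choice.on one_point.

Let openT' : [set: set one_point] setT. Proof. by []. Qed.
Let openI' : setI_closed [set: set one_point]. Proof. by []. Qed.
Let open_bigU (I : Type) (f : I -> set one_point) :
  (forall i, [set: set one_point] (f i)) -> [set: set one_point] (\bigcup_i f i).
Proof. by []. Qed.

HB.instance Definition _ :=
  isOpenTopological.Build one_point openT' openI' open_bigU.

Implicit Types U V W : opens one_point.

(** K-valued functions on U: this is the zero ring when U is empty and K otherwise. *)
Definition point_sect U : comPzRingType := {x | oset U x} -> K.

Definition point_res U V (h : V `<=` U) (s : point_sect U) : point_sect V :=
  fun y => s (exist _ (sval y) (h _ (svalP y))).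

Lemma point_res_zmod U V (h : V `<=` U) : zmod_morphism (point_res h).
Proof. by []. Qed.

Lemma point_res_monoid U V (h : V `<=` U) : monoid_morphism (point_res h).
Proof. by []. Qed.

HB.instance Definition _ U V (h : V `<=` U) :=
  GRing.isZmodMorphism.Build _ _ (point_res h) (point_res_zmod h).
HB.instance Definition _ U V (h : V `<=` U) :=
  GRing.isMonoidMorphism.Build _ _ (point_res h) (point_res_monoid h).

Lemma point_sect_irr U (s : point_sect U) (x y : {x | oset U x}) : s x = s y.
Proof.
by congr s; case: x y => -[] hx [[] hy]; rewrite (Prop_irrelevance hx hy).
Qed.

Lemma point_res_id U (h : U `<=` U) s : point_res h s = s.
Proof. apply/funext => y. exact: (point_sect_irr s). Qed.

Lemma point_res_comp U V W (h1 : V `<=` U) (h2 : W `<=` V) (h3 : W `<=` U) s :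
  point_res h2 (point_res h1 s) = point_res h3 s.
Proof. apply/funext => y. exact: (point_sect_irr s). Qed.

(** Restriction to intersections shows that all local sections take one common value at the
    point. *)
Lemma point_sheaf (C : Type) U (V : C -> opens one_point)
    (h : forall c, V c `<=` U) : U `<=` \bigcup_c V c ->
    forall s : forall c, point_sect (V c),
    (forall c d W (hc : W `<=` V c) (hd : W `<=` V d),
      point_res hc (s c) = point_res hd (s d)) ->
    exists! t : point_sect U, forall c, point_res (h c) t = s c.
Proof.
move=> cover s compat.
have {}compat c d x y : s c x = s d y.
  case: x y => -[] hc [[] hd].
  pose W := Opens (openI (oopen (V c)) (oopen (V d))).
  have hW : oset W tt by [].
  pose Wc : W `<=` V c := @subIsetl _ _ _; pose Wd : W `<=` V d := @subIsetr _ _ _.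
  have -> : s c (exist _ tt hc) = point_res Wc (s c) (exist _ tt hW).
    exact: (point_sect_irr (s c)).
  rewrite (compat c d W Wc Wd); exact: (point_sect_irr (s d)).
have [t tP] : exists t : point_sect U, forall y c x, t y = s c x.
  have ex (y : {x | oset U x}) : exists z, forall c x, z = s c x.
    by case: (cover _ (svalP y)) => c _ hc; exists (s c (exist _ _ hc)) => d x.
  by have [t tP] := choice ex; exists t.
exists t; split=> [c|t' t'P]; first by apply/funext => y; apply: tP.
apply/funext => y; case: (cover _ (svalP y)) => c _ hc.
rewrite (tP y c (exist _ _ hc)) -t'P; exact: (point_sect_irr (t' : point_sect U)).
Qed.

Definition point_scal (c : k) : point_sect (opensT one_point) := fun=> iota c.

Lemma point_scal_zmod : zmod_morphism point_scal.
Proof. by move=> a b; apply/funext => y; rewrite /point_scal rmorphB. Qed.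

Lemma point_scal_monoid : monoid_morphism point_scal.
Proof.
by split=> [|a b]; apply/funext => y; rewrite /point_scal ?rmorph1 ?rmorphM.
Qed.

HB.instance Definition _ :=
  GRing.isZmodMorphism.Build _ _ point_scal point_scal_zmod.
HB.instance Definition _ :=
  GRing.isMonoidMorphism.Build _ _ point_scal point_scal_monoid.

Definition point_ringed_space : ringed_space k :=
  @RingedSpace k one_point point_sect point_res point_res_id point_res_comp
    point_sheaf point_scal.

Local Notation Y := point_ringed_space.
Local Notation T := (opensT Y).
Local Notation pt := (exist (fun x : one_point => oset T x) tt I).

Lemma point_unit_at (s : sect Y T) (y : Y) : unit_at s y <-> (s : point_sect T) pt != 0.
Proof.
split=> [[V [h [Vy [t e]]]]|s0].
  have /(congr1 (fun f => f (exist _ y Vy))) : point_res h s * (t : point_sect V) = 1 := e.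
  rewrite -[LHS]/((s : point_sect T) _ * _) (point_sect_irr _ _ pt) => st.
  by apply: contra_eq_neq st => ->; rewrite mul0r eq_sym oner_eq0.
exists T, (fun _ H => H); split=> //.
exists ((fun z => ((s : point_sect T) z)^-1) : point_sect T).
apply/funext => z; transitivity ((s : point_sect T) z / (s : point_sect T) z).
  by congr (_ * _); apply: (point_sect_irr (s : point_sect T)).
by rewrite mulfV // (point_sect_irr (s : point_sect T) z pt).
Qed.

Lemma point_sect_eq (s t : point_sect T) : s pt = t pt -> s = t.
Proof.
move=> e; apply/funext => y.
by rewrite (point_sect_irr s y pt) e; apply: (point_sect_irr t).
Qed.

Lemma point_sect_inv (s : point_sect T) : s pt != 0 ->
  exists t : point_sect T, t * s = 1.
Proof.
by move=> s0; exists (fun=> (s pt)^-1); apply: point_sect_eq; apply: mulVf.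
Qed.

Lemma point_non_units (y : Y) :
  non_units_at T y = [set s | (s : point_sect T) pt = 0].
Proof.
apply/seteqP; split=> s; rewrite /non_units_at /= point_unit_at.
  by move/negP; rewrite negbK => /eqP.
by move=> ->; rewrite eqxx.
Qed.

Lemma point_affine : affine T.
Proof.
split.
- move=> y _; rewrite point_non_units; split=> [|/eqP|s t /eqP].
  + split=> [//|s t /= hs ht|c s /= hs].
      by rewrite [LHS](_ : _ = (s : point_sect T) pt + (t : point_sect T) pt) // hs ht addr0.
    by rewrite [LHS](_ : _ = (c : point_sect T) pt * (s : point_sect T) pt) // hs mulr0.
  + by apply/negP; apply: oner_neq0.
  + rewrite (_ : (_ * _ : point_sect T) pt = (s : point_sect T) pt * (t : point_sect T) pt) //.
    by rewrite mulf_eq0 => /orP[/eqP|/eqP]; [left|right].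
(* Nonzero sections are invertible, so a prime can only be the zero ideal. *)
- move=> P [[P0 _ PM] P1 _]; exists tt; split=> [|[]//]; split=> //.
  rewrite point_non_units; apply/seteqP; split=> s /=.
    by move=> s0; rewrite [s](_ : _ = 0) //; apply: point_sect_eq.
  move=> Ps; apply: contrapT => /eqP /point_sect_inv[t ts].
  by apply: P1; rewrite -ts; apply: PM.
- move=> x V _ Vx; exists 1; first by apply/point_unit_at; apply: oner_neq0.
  by case: x Vx => Vx [].
(* If s = 0, then D(s) is empty and its zero ring is the localization at 0; otherwise D(s) is the
   whole point and restriction is bijective. *)
move=> s V h hV; have [s0|s0] := eqVneq ((s : point_sect T) pt) 0.
  have noV y : ~ oset V y.
    by move=> /hV[_ /point_unit_at]; rewrite s0 eqxx.
  split=> [|b|a _].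
  + by exists 0; apply/funext => -[y Vy]; case: (noV y Vy).
  + by exists 0, 0%N; apply/funext => -[y Vy]; case: (noV y Vy).
  + exists 1%N; apply: point_sect_eq.
    by rewrite [LHS](_ : _ = (s : point_sect T) pt * (a : point_sect T) pt) // s0 mul0r.
have Vt : oset V tt by apply/hV; split=> //; apply/point_unit_at.
have [t ts] := point_sect_inv s0.
split=> [|b|a].
- by exists (res h t); rewrite mulrC -rmorphM /= [t * s]ts rmorph1.
- exists ((fun=> (b : point_sect V) (exist _ tt Vt)) : point_sect T), 0%N.
  rewrite mul1r; apply/funext => y; exact: (point_sect_irr (b : point_sect V)).
- move=> /(congr1 (fun f : point_sect V => f (exist _ tt Vt))) e.
  exists 0%N; rewrite mul1r; apply: point_sect_eq.
  by rewrite -[RHS]e; apply: (point_sect_irr (a : point_sect T)).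
Qed.

Definition point_scheme : scheme k.
Proof. by exists Y => x; exists T => //; exact: point_affine. Defined.

Lemma point_affine_noetherian : affine_noetherian point_scheme.
Proof.
split; first exact: point_affine.
move=> J [J0 JD JM].
have [[s Js s0]|noJ] := pselect (exists2 s, J s & (s : point_sect T) pt != 0).
  have [t ts] := point_sect_inv s0.
  exists [:: s]; apply/seteqP; split=> [u _ I [[_ _ IM] sI]|].
    have -> : u = (u * t) * s by rewrite -mulrA [t * s]ts mulr1.
    by apply: IM; apply: sI; rewrite /= inE.
  by apply: smallest_sub => // u /=; rewrite inE => /eqP->.
exists [::]; apply/seteqP; split=> [s Js I [[I0 _ _] _]|].
  rewrite [s](_ : _ = 0) //; apply: point_sect_eq.
  by apply: contrapT => /eqP s0; apply: noJ; exists s.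
by apply: smallest_sub.
Qed.

End Point.

(** * The residue field at a point of a scheme *)

Section ResiduePoint.
Variables (k : fieldType) (X : scheme k) (x : X).
Variables (V : opens X) (Vx : oset V x) (affV : affine V).
Variables (K : fieldType) (kappa : {rmorphism sect X V -> K}).
Hypothesis kappa0 : forall a, kappa a = 0 <-> non_units_at V x a.

Implicit Types (U W : opens X).

Definition opensI U W : opens X := Opens (openI (oopen U) (oopen W)).

(* z is the value at x of the section s, written near x as c / a. *)
Definition value_at U (s : sect X U) (z : K) : Prop :=
  exists W (hU : W `<=` U) (hV : W `<=` V) a c,
    [/\ oset W x, kappa a != 0, res hV a * res hU s = res hV c
      & kappa a * z = kappa c].

Lemma kappa_unit a : kappa a != 0 <-> unit_at a x.
Proof.
split=> [a0|ua]; last by apply/eqP => /kappa0.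
by apply: contrapT => nu; move/eqP: a0; apply; apply/kappa0.
Qed.

(** Otherwise a would be both 0 and a unit near x, making 0 a unit at x, against [kappa 0 = 0]. *)
Lemma kappa_res0 W (hV : W `<=` V) a : oset W x -> res hV a = 0 -> kappa a = 0.
Proof.
move=> Wx a0; apply: contrapT => /eqP /kappa_unit [W' [h' [W'x [t e]]]].
have h : opensI W W' `<=` W := @subIsetl _ _ _.
have h1 : opensI W W' `<=` W' := @subIsetr _ _ _.
have hVI : opensI W W' `<=` V := subset_trans h hV.
have e1 : res hVI a * res h1 t = 1 by rewrite -(res_comp h' h1) -rmorphM e rmorph1.
have e0 : res hVI a = 0 by rewrite -(res_comp hV h) a0 rmorph0.
have /kappa_unit : unit_at (0 : sect X V) x; last by rewrite rmorph0 eqxx.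
exists (opensI W W'), hVI; split=> //; exists (res h1 t).
by rewrite rmorph0 -[X in X * _]e0.
Qed.

Lemma value_at_inj U (s : sect X U) z z' : value_at s z -> value_at s z' -> z = z'.
Proof.
move=> [W [hU [hV [a [c [Wx a0 e ez]]]]]] [W' [hU' [hV' [a' [c' [W'x a'0 e' ez']]]]]].
have h : opensI W W' `<=` W := @subIsetl _ _ _.
have h' : opensI W W' `<=` W' := @subIsetr _ _ _.
have hVI : opensI W W' `<=` V := subset_trans h hV.
have hUI : opensI W W' `<=` U := subset_trans h hU.
have eI : res hVI a * res hUI s = res hVI c.
  by rewrite -(res_comp hV h) -(res_comp hU h) -(res_comp hV h) -rmorphM e.
have eI' : res hVI a' * res hUI s = res hVI c'.
  by rewrite -(res_comp hV' h') -(res_comp hU' h') -(res_comp hV' h') -rmorphM e'.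
have /kappa_res0 : res hVI (a' * c - a * c') = 0.
  by rewrite rmorphB !rmorphM -eI -eI' mulrCA subrr.
move=> /(_ (conj Wx W'x)); rewrite rmorphB !rmorphM -ez -ez'.
by rewrite mulrCA -!mulrBr => /eqP; rewrite !mulf_eq0 (negPf a0) (negPf a'0) subr_eq0 => /eqP.
Qed.

(** Some basic open set D(a) of V contains x and lies in U; its sections are fractions with powers
    of a as denominators. *)
Lemma value_at_ex U (s : sect X U) : oset U x -> exists z, value_at s z.
Proof.
move=> Ux; have [_ _ basis loc] := affV.
have [a ua aU] := basis x U Vx Ux.
pose D := [set y | oset V y /\ unit_at a y].
have oD : open D.
  rewrite openE => y [Vy [W [h [Wy [t e]]]]].
  have oW : open_nbhs y (V `&` W) by split=> //; apply: openI; apply: oopen.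
  apply: filterS (open_nbhs_nbhs oW) => z [Vz Wz]; split=> //.
  by exists W, h; split=> //; exists t.
pose W := Opens oD; have hV : W `<=` V by move=> y [].
have hU : W `<=` U by move=> y [/aU].
have [_ surj _] := loc a W hV (fun y => iff_refl _).
have [c [m e]] := surj (res hU s).
exists (kappa c / kappa a ^+ m), W, hU, hV, (a ^+ m), c.
have a0 : kappa a != 0 by apply/kappa_unit.
split=> //; rewrite ?rmorphXn ?expf_neq0 //.
by rewrite mulrC divfK // expf_neq0.
Qed.

Lemma value_at_ring U (s t : sect X U) z w : value_at s z -> value_at t w ->
  value_at (s - t) (z - w) /\ value_at (s * t) (z * w).
Proof.
move=> [W [hU [hV [a [c [Wx a0 e ez]]]]]] [W' [hU' [hV' [a' [c' [W'x a'0 e' ez']]]]]].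
have h : opensI W W' `<=` W := @subIsetl _ _ _.
have h' : opensI W W' `<=` W' := @subIsetr _ _ _.
have hVI : opensI W W' `<=` V := subset_trans h hV.
have hUI : opensI W W' `<=` U := subset_trans h hU.
have eI : res hVI a * res hUI s = res hVI c.
  by rewrite -(res_comp hV h) -(res_comp hU h) -(res_comp hV h) -rmorphM e.
have eI' : res hVI a' * res hUI t = res hVI c'.
  by rewrite -(res_comp hV' h') -(res_comp hU' h') -(res_comp hV' h') -rmorphM e'.
have aa0 : kappa (a * a') != 0 by rewrite rmorphM mulf_neq0.
split.
  exists (opensI W W'), hUI, hVI, (a * a'), (a' * c - a * c'); split=> //.
    by rewrite !rmorphM !rmorphB !rmorphM -eI -eI'; ring.
  by rewrite !rmorphB !rmorphM -ez -ez'; ring.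
exists (opensI W W'), hUI, hVI, (a * a'), (c * c'); split=> //.
  by rewrite !rmorphM -eI -eI'; ring.
by rewrite !rmorphM -ez -ez'; ring.
Qed.

Lemma value_at1 U : oset U x -> value_at (1 : sect X U) 1.
Proof.
move=> Ux; have hV : opensI U V `<=` V := @subIsetr _ _ _.
exists (opensI U V), (@subIsetl _ _ _), hV, 1, 1.
by rewrite !rmorph1 !mulr1; split=> //; apply: oner_neq0.
Qed.

Lemma value_at_res U W (h : W `<=` U) (s : sect X U) z : oset W x ->
  value_at s z -> value_at (res h s) z.
Proof.
move=> Wx [W' [hU [hV [a [c [W'x a0 e ez]]]]]].
have h1 : opensI W W' `<=` W := @subIsetl _ _ _.
have h2 : opensI W W' `<=` W' := @subIsetr _ _ _.
exists (opensI W W'), h1, (subset_trans h2 hV), a, c; split=> //.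
rewrite (res_comp h h1 (subset_trans h2 hU)) -(res_comp hU h2) -(res_comp hV h2).
by rewrite -rmorphM e; apply: res_comp.
Qed.

(** Near x, s divides c, whose value is nonzero and which is therefore a unit there; this makes the
    residue morphism local. *)
Lemma value_at_unit U (s : sect X U) z : value_at s z -> z != 0 -> unit_at s x.
Proof.
move=> [W [hU [hV [a [c [Wx a0 e ez]]]]]] z0.
have /kappa_unit[W' [h' [W'x [t ct]]]] : kappa c != 0 by rewrite -ez mulf_neq0.
have h1 : opensI W W' `<=` W := @subIsetl _ _ _.
have h2 : opensI W W' `<=` W' := @subIsetr _ _ _.
exists (opensI W W'), (subset_trans h1 hU); split=> //.
have hVI : opensI W W' `<=` V := subset_trans h1 hV.
have eI : res hVI a * res (subset_trans h1 hU) s = res hVI c.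
  by rewrite -(res_comp hV h1) -(res_comp hU h1) -(res_comp hV h1) -rmorphM e.
have ctI : res hVI c * res h2 t = 1.
  by rewrite -(res_comp h' h2) -rmorphM ct rmorph1.
by exists (res hVI a * res h2 t); rewrite mulrA [_ * res hVI a]mulrC eI.
Qed.

Definition eval_at U (Ux : oset U x) (s : sect X U) : K :=
  projT1 (cid (value_at_ex s Ux)).

Lemma eval_atP U (Ux : oset U x) s : value_at s (eval_at Ux s).
Proof. by rewrite /eval_at; case: cid. Qed.

Lemma eval_at_zmod U (Ux : oset U x) : zmod_morphism (eval_at Ux).
Proof.
move=> s t; apply: value_at_inj (eval_atP _ _) _.
by have [] := value_at_ring (eval_atP Ux s) (eval_atP Ux t).
Qed.

Lemma eval_at_monoid U (Ux : oset U x) : monoid_morphism (eval_at Ux).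
Proof.
split=> [|s t]; apply: value_at_inj (eval_atP _ _) _; first exact: value_at1.
by have [] := value_at_ring (eval_atP Ux s) (eval_atP Ux t).
Qed.

HB.instance Definition _ U (Ux : oset U x) :=
  GRing.isZmodMorphism.Build _ _ (eval_at Ux) (eval_at_zmod Ux).
HB.instance Definition _ U (Ux : oset U x) :=
  GRing.isMonoidMorphism.Build _ _ (eval_at Ux) (eval_at_monoid Ux).

Definition residue_scal : {rmorphism k -> K} :=
  eval_at (U := opensT X) I \o scal X.

Local Notation Y := (point_scheme residue_scal).

Let cst_x : Y -> X := fun=> x.
Let cst_x_cont : continuous cst_x. Proof. exact: cst_continuous. Qed.

Definition residue_smap U (s : sect X U) : point_sect K (preimo cst_x_cont U) :=
  fun y => @eval_at U (svalP y) s.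

Lemma residue_smap_zmod U : zmod_morphism (@residue_smap U).
Proof. by move=> s t; apply/funext => y; apply: (rmorphB (eval_at _)). Qed.

Lemma residue_smap_monoid U : monoid_morphism (@residue_smap U).
Proof.
by split=> [|s t]; apply/funext => y; [apply: (rmorph1 (eval_at _))|apply: (rmorphM (eval_at _))].
Qed.

HB.instance Definition _ U :=
  GRing.isZmodMorphism.Build _ _ (@residue_smap U) (@residue_smap_zmod U).
HB.instance Definition _ U :=
  GRing.isMonoidMorphism.Build _ _ (@residue_smap U) (@residue_smap_monoid U).

Lemma residue_smap_res U W (h : W `<=` U)
    (h' : preimo cst_x_cont W `<=` preimo cst_x_cont U) s :
  residue_smap (res h s) = point_res h' (residue_smap s).
Proof.
apply/funext => y; apply: value_at_inj (eval_atP _ _) _.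
apply: value_at_res; [exact: (svalP y)|exact: eval_atP].
Qed.

Lemma residue_smap_local U (s : sect X U) y : oset U (cst_x y) ->
  @unit_at _ Y _ (residue_smap s) y -> unit_at s (cst_x y).
Proof.
move=> Ux [W [h [Wy [t e]]]]; apply: (value_at_unit (eval_atP Ux s)).
move/(congr1 (fun f : point_sect K W => f (exist _ y Wy))) : e.
rewrite [LHS](_ : _ = point_res h (residue_smap s) (exist _ y Wy) *
  (t : point_sect K W) (exist _ y Wy)) // => e.
apply/eqP => s0; have : value_at s (point_res h (residue_smap s) (exist _ y Wy)).
  exact: eval_atP.
move/(value_at_inj (eval_atP Ux s)); rewrite s0 => s0'.
by move: e; rewrite -s0' mul0r => /esym/eqP; apply/negP; apply: oner_neq0.
Qed.

Lemma residue_smap_scal (h : preimo cst_x_cont (opensT X) `<=` opensT Y) c :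
  residue_smap (scal X c) = point_res h (scal Y c).
Proof.
by apply/funext => y; apply: value_at_inj (eval_atP _ _) (eval_atP _ _).
Qed.

Definition residue_mor : mor Y X :=
  @Mor k Y X cst_x cst_x_cont residue_smap residue_smap_res
    residue_smap_local residue_smap_scal.

End ResiduePoint.

Lemma residue_point (k : fieldType) (X : scheme k) (x : X) :
  exists (K : fieldType) (iota : {rmorphism k -> K})
    (f : mor (point_scheme iota) X), f tt = x.
Proof.
have [V Vx affV] := locally_affine x.
have [prime_x _ _ _] := affV.
have [K [kappa [kappa0 _]]] := prime_residue_field (prime_x x Vx).
by exists K, (residue_scal Vx affV kappa0), (residue_mor Vx affV kappa0).
Qed.

(** * Morphisms and the cover of the Grassmannian *)

Section UnitLocalization.
Variables (A B : comPzRingType) (phi : {rmorphism A -> B}) (f f' : A).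
Hypothesis loc : localization_away f phi.
Hypothesis ff' : f * f' = 1.

Let fX m : f' ^+ m * f ^+ m = 1.
Proof. by rewrite -exprMn mulrC ff' expr1n. Qed.

Lemma unit_localization_inj a : phi a = 0 -> a = 0.
Proof.
by case: loc => _ _ ker /ker[m e]; rewrite -[a]mul1r -(fX m) -mulrA e mulr0.
Qed.

Lemma unit_localization_surj b : exists a, phi a = b.
Proof.
case: loc => _ surj _; have [a [m e]] := surj b; exists (f' ^+ m * a).
by rewrite rmorphM -e mulrA -rmorphXn -rmorphM fX rmorph1 mul1r.
Qed.

Lemma unit_localization_mx_inj m n (M : 'M[A]_(m, n)) : map_mx phi M = 0 -> M = 0.
Proof.
move=> /matrixP e; apply/matrixP => i j; have := e i j; rewrite !mxE.
exact: unit_localization_inj.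
Qed.

Lemma unit_localization_mx_surj m n (M : 'M[B]_(m, n)) : exists M', map_mx phi M' = M.
Proof.
have [g gP] := choice unit_localization_surj.
by exists (map_mx g M); apply/matrixP => i j; rewrite !mxE gP.
Qed.

Lemma unit_localization_base_change N (L : set 'rV[A]_N) v :
  submodule L -> base_change phi L (map_mx phi v) -> L v.
Proof.
move=> [L0 LD LZ].
(* As [phi] is surjective, the image of L is already a submodule. *)
have : base_change phi L `<=` map_mx phi @` L.
  apply: smallest_sub => //; split=> [|_ _ [v1 L1 <-] [v2 L2 <-]|c _ [w Lw <-]].
  - by exists 0 => //; rewrite map_mx0.
  - by exists (v1 + v2); [exact: LD|rewrite map_mxD].
  - have [a <-] := unit_localization_surj c.
    by exists (a *: w); [exact: LZ|rewrite map_mxZ].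
move=> sub /sub[w Lw e]; suff -> : v = w by [].
by apply/subr0_eq/unit_localization_mx_inj; rewrite map_mxB e subrr.
Qed.

(** [phi] is bijective here, so bases and preimages over B lift to A. *)
Lemma unit_localization_GG (k : fieldType) n r p (I : p.-tuple 'I_('C(n + r, n)))
    (g : 'M[rat]_n.+1) (iota : {rmorphism k -> A}) L : submodule L ->
  GG k n r p I g B (phi \o iota) (base_change phi L) -> GG k n r p I g A iota L.
Proof.
move=> subL [_ [b [b_span b_free]] surjL]; split=> //.
- have [b' b'E] := unit_localization_mx_surj b; exists b'; split=> [v|c Lc].
    have [c hc] := b_span (map_mx phi v).
    have [c' c'E] := unit_localization_mx_surj c; exists c'.
    by apply: unit_localization_base_change => //; rewrite map_mxB map_mxM c'E b'E.
  apply: unit_localization_mx_inj; apply: b_free.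
  by rewrite -b'E -map_mxM; apply: sub_base_change.
- move=> v; have [c hc] := surjL (map_mx phi v).
  have [c' c'E] := unit_localization_mx_surj c; exists c'.
  apply: unit_localization_base_change => //.
  by rewrite map_mxB !map_mxM c'E map_Gamma -map_mx_comp.
Qed.

End UnitLocalization.

Lemma unit_at_res (k : fieldType) (X : ringed_space k) (U W : opens X)
    (h : W `<=` U) (s : sect X U) x : unit_at (res h s) x -> unit_at s x.
Proof.
move=> [V [h' [Vx [t e]]]]; exists V, (subset_trans h' h); split=> //.
by exists t; rewrite -(res_comp h h').
Qed.

(** * Composition of morphisms *)

Section Composition.
Variables (k : fieldType) (X Y Z : scheme k) (f : mor X Y) (g : mor Y Z).

Let gf_cont : continuous (g \o f).
Proof. by move=> x; apply: continuous_comp; apply: pmap_cont. Qed.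

Let incl (U : opens Z) :
  preimo gf_cont U `<=` preimo (pmap_cont f) (preimo (pmap_cont g) U) :=
  fun _ H => H.

Definition comp_smap U : {rmorphism sect Z U -> sect X (preimo gf_cont U)} :=
  res (incl (U := U)) \o (smap f _ \o smap g U).

Lemma comp_smap_res (U V : opens Z) (h : V `<=` U)
    (h' : preimo gf_cont V `<=` preimo gf_cont U) s :
  comp_smap V (res h s) = res h' (comp_smap U s).
Proof.
rewrite /comp_smap /=.
have h1 : preimo (pmap_cont g) V `<=` preimo (pmap_cont g) U by move=> y /h.
have h2 : preimo (pmap_cont f) (preimo (pmap_cont g) V) `<=`
          preimo (pmap_cont f) (preimo (pmap_cont g) U) by move=> y /h1.
rewrite (smap_res h h1) (smap_res h1 h2).
rewrite (res_comp _ _ (subset_trans (incl (U := V)) h2)).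
by rewrite (res_comp _ _ (subset_trans (incl (U := V)) h2)).
Qed.

Lemma comp_smap_local (U : opens Z) s x : oset U ((g \o f) x) ->
  unit_at (comp_smap U s) x -> unit_at s ((g \o f) x).
Proof. by move=> Ux /unit_at_res us; apply: smap_local => //; apply: smap_local us. Qed.

Lemma comp_smap_scal (h : preimo gf_cont (opensT Z) `<=` opensT X) c :
  comp_smap (opensT Z) (scal Z c) = res h (scal X c).
Proof.
rewrite /comp_smap /=.
have hg : preimo (pmap_cont g) (opensT Z) `<=` opensT Y by [].
have hf : preimo (pmap_cont f) (opensT Y) `<=` opensT X by [].
have hf' : preimo (pmap_cont f) (preimo (pmap_cont g) (opensT Z)) `<=`
           preimo (pmap_cont f) (opensT Y) by [].
rewrite (smap_scal hg) (smap_res hg hf') (smap_scal hf).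
by rewrite (res_comp _ _ (subset_trans hf' hf)) (res_comp _ _ h).
Qed.

Definition comp_mor : mor X Z :=
  @Mor k X Z (g \o f) gf_cont comp_smap comp_smap_res comp_smap_local comp_smap_scal.

Lemma is_comp_comp_mor : is_comp f g comp_mor.
Proof.
by split=> // U s i; rewrite /= (Prop_irrelevance i (incl (U := U))).
Qed.

End Composition.

Theorem proposition3p2 (k : fieldType) (n r p : nat) (P : {poly rat})
    (chark : [pchar k] =i pred0)
    (hP : is_hilbert_polynomial k n P)
    (hr : is_gotzmann_number P r)
    (hp : P.[r%:R] = p%:R) :
  covers (Gr k p 'C(n + r, n))
    (fun c : borel_index k n r p => GG k n r p (bi_set c) (bi_mat c)) /\
  forall (X : scheme k) (rho : representation (Gr k p 'C(n + r, n)) X)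
    (U : borel_index k n r p -> scheme k)
    (sigma : forall c,
       representation (GG k n r p (bi_set c) (bi_mat c)) (U c))
    (j : forall c, mor (U c) X),
    (forall c, induces_inclusion rho (sigma c) (j c)) ->
    \bigcup_c range (j c) = [set: X].
Proof.
have cover := borel_GG_cover (n := n) (r := r) (p := p) chark.
split=> // X rho U sigma j incl; apply/seteqP; split=> // x _.
have [K [iota [f fx]]] := residue_point x.
have noethY := point_affine_noetherian iota.
have Grf := fam_in rho noethY f; have [subf _] := Grf.
(* The cover is applied at the prime of the unique point; an s outside it is a unit, so
   [unit_localization_GG] removes the localization. *)
have [prime0 _ _ _] := noethY.1.
have {}prime0 := prime0 tt I.
have [s s0 [B [phi [loc [c GGc]]]]] := cover _ _ noethY.2 _ Grf _ prime0.
have [s' ss'] : exists s', s * s' = 1.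
  have [|s' s's] := @point_sect_inv k K iota s; last by exists s'; rewrite mulrC.
  by apply/(@point_unit_at _ _ iota s tt); apply: contrapT.
have {GGc} := unit_localization_GG loc ss' subf GGc.
move=> /(fam_surj (sigma c) noethY)[u fam_u].
have comp := is_comp_comp_mor u (j c).
(* The composite of u and [j c] has the same family as f, hence agrees with f on points, and x is
   the image of [u tt]. *)
have := incl c _ noethY u _ comp; rewrite fam_u => /(fam_inj noethY)[e _].
by exists c => //; exists (u tt) => //; rewrite -fx -e.
Qed.
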